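(* Let $G$ be a compact group, and let $X\subset C(G)$ be a closed linear subspace which is invariant under left translation. Then there exists a choice of linear subspaces $E_\pi\subset H_\pi$ ($\pi\in\widehat{G}$) such that $$X=\overline{\operatorname{span}}\{\xi*_\pi\eta:\pi\in\widehat{G},\ \xi\in E_\pi,\ \eta\in H_\pi\}.$$
   Context: $C(G)$ is the Banach space of continuous complex-valued functions on $G$ with the supremum norm. Left translates of $f\in C(G)$ are the functions $t\mapsto f(s^{-1}t)$, $s\in G$. $\widehat{G}$ is the unitary dual of $G$: the set of (equivalence classes of) irreducible continuous unitary representations $(\pi,H_\pi)$ of $G$ on Hilbert spaces, one representative being fixed for each class. For $\xi,\eta\in H_\pi$, $\xi*_\pi\eta$ is the function $t\mapsto\langle\pi(t)\xi,\eta\rangle$ on $G$. *)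

(* Defs.v *)
From HB Require Import structures.
From mathcomp Require Import all_boot all_order all_algebra.
From mathcomp Require Import all_classical all_reals all_analysis.
From mathcomp Require Import complex ring lra.

Set Implicit Arguments.
Unset Strict Implicit.
Unset Printing Implicit Defensive.

Import Order.TTheory GRing.Theory Num.Theory.
Import numFieldNormedType.Exports.

Local Open Scope classical_set_scope.
Local Open Scope ring_scope.

HB.mixin Record isCompactGroup G & Group G & Topological G := {
  mulg_continuous : continuous (fun x : G * G => (x.1 * x.2)%g);
  invg_continuous : continuous (fun x : G => (x^-1)%g);
  group_compact : compact [set: G];
  group_hausdorff : hausdorff_space G
}.

#[short(type="compactGroupType")]
HB.structure Definition CompactGroup :=
  {G of Group G & Topological G & isCompactGroup G}.

(* {dot H for Num.conj}: linear in the first argument, conjugate-linear in the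
   second *)
HB.mixin Record isHilbert (R : realType) H & CompleteNormedModule R[i] H := {
  inner : {dot H for Num.conj};
  inner_norm : forall u : H, inner u u = `|u| ^+ 2
}.

#[short(type="hilbertType")]
HB.structure Definition Hilbert (R : realType) :=
  {H of CompleteNormedModule R[i] H & isHilbert R H}.

Section ContinuousFunctions.
Variables (R : realType) (G : compactGroupType).

Local Notation normc := (@Normc.normc R).

Definition continuous_pred : {pred G -> R[i]^o} :=
  mem [set f : G -> R[i]^o | continuous f].

Lemma continuous_submod_closed : submod_closed continuous_pred.
Proof.
split; first by apply: mem_set => x; exact: cst_continuous.
move=> a f g /set_mem fc /set_mem gc; apply: mem_set => x.
by apply: (@cvgD _ _ _ _ _ (a *: f) g); [apply: cvgZl_tmp; exact: fc|exact: gc].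
Qed.

HB.instance Definition _ :=
  GRing.isSubmodClosed.Build R[i] (G -> R[i]^o) continuous_pred
    continuous_submod_closed.

Record contFun := ContFun {
  contFun_val :> G -> R[i]^o;
  _ : contFun_val \in continuous_pred
}.
HB.instance Definition _ := [isSub for contFun_val].
HB.instance Definition _ := [Choice of contFun by <:].
HB.instance Definition _ := [SubChoice_isSubLmodule of contFun by <:].

Definition mkContFun (f : G -> R[i]^o) (fc : continuous f) : contFun :=
  ContFun (mem_set (fc : [set f | continuous f] f)).

Lemma contFun_continuous (f : contFun) : continuous f.
Proof. by case: f => f /= /set_mem. Qed.

Definition supnorm (f : contFun) : R := sup (range (fun t => normc (f t))).

Lemma normc_cont : continuous (normc : R[i]^o -> R).
Proof.
move=> z; apply/(@cvgrPdist_lt _ _ _ _ (nbhs_filter (z : R[i]^o))) => e e0.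
have e0' : 0 < e%:C%C :> R[i] by rewrite ltcR.
near=> w.
have : `|z - w| < e%:C%C.
  by near: w; exact: (@nbhsx_ballx _ (R[i]^o : pseudoMetricType R[i]) z _ e0').
rewrite ltcR; apply: le_lt_trans.
have H (x y : R[i]) : normc x <= normc (x - y) + normc y.
  by rewrite -{1}(subrK y x) le_normcD.
rewrite ler_norml; apply/andP; split.
  by have := H w z; rewrite -(normcN (w - z)) opprB; lra.
by have := H z w; lra.
Unshelve. all: by end_near. Qed.

Lemma supnorm_has_sup (f : contFun) :
  has_sup (range (fun t => normc (f t))).
Proof.
split; first by exists (normc (f 1%g)), 1%g.
have /compact_bounded [M [_ HM]] :
    compact (range (fun t => normc (f t)) : set R).
  apply: continuous_compact; last exact: group_compact.
  apply: continuous_subspaceT => x.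
  apply: (@continuous_comp _ _ _ f (normc : R[i]^o -> R)).
    exact: contFun_continuous.
  exact: normc_cont.
exists (M + 1) => _ [t _ <-]; apply: le_trans (ler_norm _) _.
by apply: HM; [rewrite ltrDl | exists t].
Qed.

Lemma supnorm_ub (f : contFun) t : normc (f t) <= supnorm f.
Proof. by apply: ub_le_sup; [case: (supnorm_has_sup f)|exists t]. Qed.

Lemma supnorm_le (f : contFun) (M : R) :
  (forall t, normc (f t) <= M) -> supnorm f <= M.
Proof.
move=> H; apply: ge_sup; first by case: (supnorm_has_sup f).
by move=> _ [t _ <-].
Qed.

Lemma supnormD (f g : contFun) :
  (supnorm (f + g))%:C%C <= (supnorm f)%:C%C + (supnorm g)%:C%C.
Proof.
rewrite -rmorphD lecR; apply: supnorm_le => t.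
by apply: le_trans (le_normcD _ _) _; rewrite lerD// supnorm_ub.
Qed.

Lemma supnormZ (a : R[i]) (f : contFun) :
  (supnorm (a *: f))%:C%C = `|a| * (supnorm f)%:C%C.
Proof.
have a0 : 0 <= normc a by have := normr_ge0 a; rewrite lecR.
rewrite -[`|a|]/((normc a)%:C%C) -rmorphM; congr (_%:C)%C.
have H t : normc ((a *: f) t) = normc a * normc (f t).
  by rewrite -Normc.normcM.
apply/eqP; rewrite eq_le; apply/andP; split.
  by apply: supnorm_le => t; rewrite H ler_wpM2l// supnorm_ub.
have [->|an0] := eqVneq (normc a) 0.
  rewrite mul0r; apply: le_trans (supnorm_ub _ 1%g).
  by rewrite H mulr_ge0//; have := normr_ge0 (f 1%g); rewrite lecR.
have ap : 0 < normc a by rewrite lt_def an0.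
rewrite -ler_pdivlMl//; apply: supnorm_le => t.
by rewrite ler_pdivlMl// -H supnorm_ub.
Qed.

Lemma supnorm_eq0 (f : contFun) : (supnorm f)%:C%C = 0 -> f = 0.
Proof.
move=> [f0]; apply/val_inj/funext => t /=; apply: Normc.eq0_normc.
apply/eqP; rewrite eq_le -{1}f0 supnorm_ub/=.
by have := normr_ge0 (f t); rewrite lecR.
Qed.

(* the library's norms take their values in the scalar field, here R[i] *)
HB.instance Definition _ :=
  Lmodule_isNormed.Build R[i] contFun supnormD supnormZ supnorm_eq0.

End ContinuousFunctions.

Section LeftTranslation.
Variables (R : realType) (G : compactGroupType).

Lemma left_translate_continuous (s : G) (f : contFun R G) :
  continuous (fun t : G => f (s^-1 * t)%g : R[i]^o).
Proof.
move=> t; apply: (@continuous_comp _ _ _ (fun t : G => (s^-1 * t)%g) f);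
  last exact: contFun_continuous.
apply: (@continuous_comp _ _ _ (fun t : G => (s^-1%g, t))
  (fun x : G * G => (x.1 * x.2)%g)); last exact: mulg_continuous.
by apply: cvg_pair; [exact: cvg_cst|exact: cvg_id].
Qed.

Definition left_translate (s : G) (f : contFun R G) : contFun R G :=
  mkContFun (@left_translate_continuous s f).

End LeftTranslation.

Section Span.
Variables (K : pzRingType) (V : lmodType K).

Definition linear_subspace (E : set V) : Prop := submod_closed (mem E).

Definition linear_span (A : set V) : set V := smallest linear_subspace A.

End Span.

Section InnerProduct.
Variables (R : realType) (H : hilbertType R).

Lemma inner_CauchySchwarz (u v : H) : `|inner u v| <= `|u| * `|v|.
Proof.
have [->|v0] := eqVneq v 0; first by rewrite linear0r !normr0 mulr0.
have nv0 : inner v v != 0 by rewrite dnorm_eq0.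
pose a := inner u v / inner v v; pose w := u - a *: v.
have ow : inner w v = 0.
  by rewrite linearBl/= linearZl_LR/= divfK// subrr.
have uE : u = w + a *: v by rewrite subrK.
have uvE : inner u v = a * inner v v by rewrite divfK.
have nuE : inner u u = inner w w + `|a| ^+ 2 * inner v v.
  have ow' : inner w (a *: v) = 0 by rewrite linearZr_LR/= ow mulr0.
  by rewrite {1 2}uE (hnormDd ow')/= dnormZ.
rewrite -(@ler_pXn2r _ 2) ?nnegrE ?mulr_ge0//.
rewrite exprMn -!inner_norm uvE normrM exprMn nuE (ger0_norm (dnorm_ge0 _ _)).
by rewrite mulrDl expr2 mulrA lerDr mulr_ge0 ?dnorm_ge0.
Qed.

Lemma inner_continuousl (v : H) :
  continuous ((fun u => inner u v) : H -> R[i]^o).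
Proof.
move=> u; apply/cvgrPdist_lt => e e0.
have k0 : 0 < `|v| + 1 by rewrite ltr_wpDl.
near=> w.
rewrite -linearBl/= (le_lt_trans (inner_CauchySchwarz _ _))//.
apply: (@le_lt_trans _ _ (`|u - w| * (`|v| + 1))).
  by rewrite ler_wpM2l// lerDl.
rewrite -ltr_pdivlMr//; near: w.
by apply: cvgr_dist_lt; rewrite ?divr_gt0//; exact: cvg_id.
Unshelve. all: by end_near. Qed.

End InnerProduct.

Section Representations.
Variables (R : realType) (G : compactGroupType).

Record unitaryRep := UnitaryRep {
  rep_space : hilbertType R;
  rep_fun :> G -> {linear rep_space -> rep_space};
  rep_fun1 : forall u, rep_fun 1%g u = u;
  rep_funM : forall s t u, rep_fun (s * t)%g u = rep_fun s (rep_fun t u);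
  rep_unitary : forall s u v, inner (rep_fun s u) (rep_fun s v) = inner u v;
  rep_continuous : forall u, continuous (fun t => rep_fun t u)
}.

Definition rep_invariant (p : unitaryRep) (W : set (rep_space p)) : Prop :=
  forall t u, W u -> W (p t u).

Definition irreducible (p : unitaryRep) : Prop :=
  (exists u : rep_space p, u != 0) /\
  forall W : set (rep_space p), closed W -> linear_subspace W ->
    rep_invariant W -> W = [set 0] \/ W = setT.

Definition unitarily_equivalent (p q : unitaryRep) : Prop :=
  exists U : {linear rep_space p -> rep_space q},
    [/\ forall v, exists u, U u = v,
        forall u v, inner (U u) (U v) = inner u v &
        forall t u, U (p t u) = q t (U u)].

Record irrep := Irrep {
  irrep_rep :> unitaryRep;
  irrepP : irreducible irrep_rep
}.

(* An element of the dual is a whole unitary equivalence class, given by its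
   membership predicate; set (irrep R G) is avoided because the library makes
   sets a choiceType, which would put irrep below the universe of the carriers
   it quantifies over. *)
Record unitary_dual := UnitaryDual {
  dual_class :> irrep -> Prop;
  dual_classP : exists p : irrep,
    dual_class = (fun q => unitarily_equivalent p q)
}.

Lemma coef_continuous (p : unitaryRep) (xi eta : rep_space p) :
  continuous (fun t : G => inner (p t xi) eta : R[i]^o).
Proof.
move=> t; apply: (@continuous_comp _ _ _ (fun t => p t xi)
  ((fun u => inner u eta) : _ -> R[i]^o)); first exact: rep_continuous.
exact: inner_continuousl.
Qed.

Definition coef (p : unitaryRep) (xi eta : rep_space p) : contFun R G :=
  mkContFun (@coef_continuous p xi eta).

End Representations.

(* Main.v *)
(* Let E_c be the set of xi all of whose coefficients xi * eta lie in X, and Y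
   the span of these coefficients.  The point is that Y is dense in X.

   The invariant mean on C(G) is obtained as in von Neumann's work on almost
   periodic functions: finite averages of translates of f become uniformly
   close to a constant.  For f in X, the bi-invariant pseudometric
   d(s) = sup |f(usv) - f(uv)| gives a central symmetric bump
   phi = max(0, e - d), and convolution T by phi is a self-adjoint
   Hilbert-Schmidt operator which preserves X, commutes with translations and
   is close on f to a multiple of the identity.  An eigenspace of T in X is
   left-invariant and finite-dimensional; in an orthonormal basis b_i of a
   minimal left-invariant subspace of it, the complex conjugates of the
   matrices of left translation form an irreducible representation, and each
   element of the subspace is a coefficient of it with xi = (b_i(1))_i.  So T
   has norm at most e on the complement, within X, of a suitable
   finite-dimensional invariant subspace of Y, which makes T (T f) uniformly
   close to Y. *)

Require Import Defs.
From HB Require Import structures.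
From mathcomp Require Import all_boot all_order all_algebra.
From mathcomp Require Import all_classical all_reals all_analysis.
From mathcomp Require Import complex ring lra.

Set Implicit Arguments.
Unset Strict Implicit.
Unset Printing Implicit Defensive.

Import Order.TTheory GRing.Theory Num.Theory.
Import numFieldNormedType.Exports.

Local Open Scope classical_set_scope.
Local Open Scope ring_scope.

(** [mean] plays the role of the Haar integral and [ip] that of the inner product of L2. As C(G) is
    not complete for [ip], the spectral theorem is not directly available. Completeness is replaced
    by the fact that [T] turns mean-square bounds into uniform ones: by Cauchy-Schwarz the image of
    the unit ball is bounded and equicontinuous, so limits are taken only after applying [T]. This
    is also why [T] is applied twice at the end: on the orthogonal remainder the first [T] gives
    smallness in mean square only, and the second makes it uniform.

    The bump is central because of two demands. Convolving by [phi] on the left averages left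
    translates, which keeps the result in [X]; but such an operator commutes with left translation
    only thanks to [phi (x y) = phi (y x)], and this makes its eigenspaces invariant.

    Dimension is never defined. It is measured by the length of orthonormal lists, and Bessel's
    inequality for the kernel bounds that length wherever [T] is bounded below. *)

Section ComplexContinuity.
Variables (R : realType).
Local Notation C := R[i].
Local Notation normc := (@Normc.normc R).
Local Notation Re := (@complex.Re R).
Local Notation Im := (@complex.Im R).

Lemma normc_ge0 (z : C) : 0 <= normc z :> R.
Proof. by have := normr_ge0 z; rewrite lecR. Qed.

Lemma normc_le (z : C) (e : R) : (`|z| <= e%:C%C :> C) = (normc z <= e :> R).
Proof. by rewrite -lecR. Qed.

Lemma normc_distC (z w : C) : normc (z - w) = normc (w - z).
Proof. by rewrite -normcN opprB. Qed.

Lemma normc_triangle (z x y : C) : normc (x - y) <= normc (x - z) + normc (z - y).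
Proof. by rewrite -(subrKA z) le_normcD. Qed.

Lemma normc_conj (z : C) : normc (z^*)%C = normc z.
Proof. by case: z => a b /=; rewrite sqrrN. Qed.

Lemma normc_Re (z : C) : `|Re z| <= normc z.
Proof. by have := normc_ge_Re z; rewrite lecR. Qed.

Lemma normc_Im (z : C) : `|Im z| <= normc z.
Proof.
by rewrite -normrN -ReiNIm (le_trans (normc_Re _))// Normc.normcM /= expr0n /=
  add0r expr1n sqrtr1 mulr1.
Qed.

Lemma normc_ReIm (z : C) : normc z <= `|Re z| + `|Im z|.
Proof.
rewrite {1}[z]complexE (le_trans (le_normcD _ _))// Normc.normcM /= !expr0n /=.
by rewrite addr0 !add0r expr1n sqrtr1 mul1r addr0 !sqrtr_sqr.
Qed.

Lemma normc_real (x : R) : normc x%:C%C = `|x|.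
Proof. by rewrite /= expr0n /= addr0 sqrtr_sqr. Qed.

(* Epsilon-style continuity for the norm [normc], equivalent to continuity into
   [C^o]: it keeps the topological structure of [C^o] out of unification. *)
Definition ccontinuous (T : topologicalType) (f : T -> C) : Prop :=
  forall x (e : R), 0 < e -> \forall y \near x, normc (f x - f y) < e.

Lemma ccontinuousP (T : topologicalType) (f : T -> C) :
  ccontinuous f <-> continuous (f : T -> C^o).
Proof.
split=> [H x|fc x e e0].
  apply/(@cvgrPdist_lt C C^o _ _ (nbhs_filter x)) => e e0.
  have eE : e = (Re e)%:C%C by rewrite RRe_real// gtr0_real.
  have e0' : 0 < Re e by rewrite -ltcR -eE.
  by near do rewrite eE ltcR; exact: H.
have e0' : 0 < e%:C%C :> R[i] by rewrite ltcR.
have := @cvgr_dist_lt C C^o _ _ (nbhs_filter x) _ _ (fc x) _ e0'.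
by apply: filterS => y; rewrite ltcR.
Unshelve. all: by end_near. Qed.

Lemma ccontinuous_comp (T U : topologicalType) (f : T -> U) (g : U -> C) :
  continuous f -> ccontinuous g -> ccontinuous (fun x => g (f x)).
Proof. by move=> fc gc x e e0; exact: (fc x _ (gc (f x) e e0)). Qed.

Lemma ccontinuous_cst (T : topologicalType) (c : C) :
  ccontinuous (fun _ : T => c).
Proof. by move=> x e e0; near=> y; rewrite subrr Normc.normc0.
Unshelve. all: by end_near. Qed.

Lemma ccontinuousM (T : topologicalType) (f g : T -> C) :
  ccontinuous f -> ccontinuous g -> ccontinuous (fun x => f x * g x).
Proof.
move=> /ccontinuousP fc /ccontinuousP gc; apply/ccontinuousP => x.
by apply: (@cvgM C); [exact: fc|exact: gc].
Qed.

Lemma ccontinuousD (T : topologicalType) (f g : T -> C) :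
  ccontinuous f -> ccontinuous g -> ccontinuous (fun x => f x + g x).
Proof.
move=> /ccontinuousP fc /ccontinuousP gc; apply/ccontinuousP => x.
by apply: (@cvgD C C^o); [exact: fc|exact: gc].
Qed.

Lemma ccontinuousN (T : topologicalType) (f : T -> C) :
  ccontinuous f -> ccontinuous (fun x => - f x).
Proof.
move=> fc x e e0; have := fc x e e0; apply: filterS => y.
by rewrite -opprD normcN.
Qed.

Lemma ccontinuousB (T : topologicalType) (f g : T -> C) :
  ccontinuous f -> ccontinuous g -> ccontinuous (fun x => f x - g x).
Proof. by move=> fc gc; apply: ccontinuousD fc _; exact: ccontinuousN. Qed.

Lemma ccontinuous_conj (T : topologicalType) (f : T -> C) :
  ccontinuous f -> ccontinuous (fun x => ((f x)^*)%C).
Proof.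
move=> fc x e e0; have := fc x e e0; apply: filterS => y.
by rewrite -rmorphB normc_conj.
Qed.

Lemma ccontinuous_sum (T : topologicalType) (I : Type) (s : seq I)
    (F : I -> T -> C) :
  (forall i, ccontinuous (F i)) -> ccontinuous (fun x => \sum_(i <- s) F i x).
Proof.
move=> Fc; elim: s => [|a s IH].
  by under eq_fun do rewrite big_nil; exact: ccontinuous_cst.
under eq_fun do rewrite big_cons.
exact: ccontinuousD (Fc a) IH.
Qed.

Lemma ccontinuous_real (T : topologicalType) (f : T -> R) :
  continuous f -> ccontinuous (fun x => (f x)%:C%C).
Proof.
move=> fc x e e0.
have := @cvgr_dist_lt R R^o _ _ (nbhs_filter x) _ _ (fc x) _ e0.
by apply: filterS => y; rewrite -rmorphB normc_real.
Qed.

Lemma continuous_Re (T : topologicalType) (f : T -> C) :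
  ccontinuous f -> continuous (fun x => Re (f x)).
Proof.
move=> fc x; apply/(@cvgrPdist_lt R R^o _ _ (nbhs_filter x)) => e e0.
have := fc x e e0; apply: filterS => y; apply: le_lt_trans.
by rewrite -raddfB normc_Re.
Qed.

Lemma continuous_Im (T : topologicalType) (f : T -> C) :
  ccontinuous f -> continuous (fun x => Im (f x)).
Proof.
move=> fc x; apply/(@cvgrPdist_lt R R^o _ _ (nbhs_filter x)) => e e0.
have := fc x e e0; apply: filterS => y; apply: le_lt_trans.
by rewrite -raddfB normc_Im.
Qed.

End ComplexContinuity.

(** * Compactness: finite nets and uniformity over a compact factor *)

Section Compactness.
Variable R : realType.
Local Notation normc := (@Normc.normc R).
Local Notation Re := (@complex.Re R).
Local Notation Im := (@complex.Im R).

(** Near-covering compactness for the filter of finite lists ordered by inclusion: near [a], every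
    list that contains [a] has the required element. *)
Lemma finite_net (T : topologicalType) (P : T -> T -> Prop) :
  compact [set: T] -> (forall a, \forall t \near a, P a t) ->
  exists s : seq T, forall t, exists2 a, a \in s & P a t.
Proof.
move=> /compact_near_coveringP K HP.
pose F := filter_from [set: seq T] (fun l => [set l' : seq T | {subset l <= l'}]).
have FF : Filter F.
  apply: filter_from_filter; first by exists [::].
  move=> l l' _ _; exists (l ++ l') => // m /= lm; split=> x xl; apply: lm;
    by rewrite mem_cat xl ?orbT.
have [a _|l _ H] := K _ F (fun l t => exists2 a, a \in l & P a t) FF.
  exists ([set t | P a t], [set l : seq T | a \in l]) => /=; last first.
    by move=> [t l] /= [Pt al]; exists a.
  split; first exact: HP.
  by exists [:: a] => // l /=; apply; rewrite mem_head.
by exists l => t; apply: (H l) => //=.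
Qed.

(** Tube lemma. Both values at [x'] are compared with the value at the centre [(a0, x)] of a product
    neighbourhood, whence [e / 2]. It serves as uniform continuity, with no uniform structure on the
    group. *)
Lemma uniform_near (A K : topologicalType) (F : A * K -> R[i]) :
  compact [set: K] -> ccontinuous F ->
  forall a0 (e : R), 0 < e ->
  \forall a \near a0, forall x, normc (F (a0, x) - F (a, x)) < e.
Proof.
move=> /compact_near_coveringP cK Fc a0 e e0.
suff: \forall a \near a0, [set: K] `<=` (fun x => normc (F (a0, x) - F (a, x)) < e).
  by apply: filterS => a H x; exact: H.
apply: cK => x _.
have e20 : 0 < e / 2 by rewrite divr_gt0.
have [[U V] [/= U0 Vx] HUV] := Fc (a0, x) _ e20.
exists (V, U) => //= -[x' a] /= [Vx' Ua].
have H1 := HUV (a0, x') (conj (nbhs_singleton U0) Vx').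
have H2 := HUV (a, x') (conj Ua Vx').
rewrite -(subrKA (F (a0, x))) (le_lt_trans (le_normcD _ _))//.
by rewrite /= in H1 H2; rewrite normc_distC; lra.
Unshelve. all: by end_near. Qed.

Lemma uniform_near_real (A K : topologicalType) (F : A * K -> R) :
  compact [set: K] -> continuous F ->
  forall a0 (e : R), 0 < e ->
  \forall a \near a0, forall x, `|F (a0, x) - F (a, x)| < e.
Proof.
move=> cK Fc a0 e e0.
have := uniform_near cK (ccontinuous_real Fc) a0 e0.
by apply: filterS => a H x; rewrite -normc_real rmorphB; exact: H.
Qed.

End Compactness.

(** * Finite averages of translates *)

Section FiniteAverages.
Variable K : numFieldType.

(** A list rather than a finite set: repetitions count, so averages compose along products of lists.
    The empty list gives [0], hence the assumptions [0 < size s] below. *)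
Definition avg (T : Type) (s : seq T) (F : T -> K) : K :=
  (\sum_(a <- s) F a) / (size s)%:R.

Lemma eq_avg (T : Type) (s : seq T) (F F' : T -> K) :
  F =1 F' -> avg s F = avg s F'.
Proof. by move=> H; rewrite /avg; under eq_bigr do rewrite H. Qed.

Lemma avg_cst (T : Type) (s : seq T) c : (0 < size s)%N -> avg s (fun=> c) = c.
Proof.
move=> s0; rewrite /avg big_const_seq iter_addr_0 count_predT -[c *+ _]mulr_natr.
by rewrite mulfK// pnatr_eq0 -lt0n.
Qed.

Lemma avgD (T : Type) (s : seq T) (F F' : T -> K) :
  avg s (fun a => F a + F' a) = avg s F + avg s F'.
Proof. by rewrite /avg big_split /= mulrDl. Qed.

Lemma avgZ (T : Type) (s : seq T) c (F : T -> K) :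
  avg s (fun a => c * F a) = c * avg s F.
Proof. by rewrite /avg -mulr_sumr mulrA. Qed.

Lemma avgB (T : Type) (s : seq T) (F F' : T -> K) :
  avg s (fun a => F a - F' a) = avg s F - avg s F'.
Proof. by rewrite /avg sumrB mulrBl. Qed.

Lemma avgN (T : Type) (s : seq T) (F : T -> K) :
  avg s (fun a => - F a) = - avg s F.
Proof. by rewrite /avg sumrN mulNr. Qed.

Lemma avg_map (T T' : Type) (h : T -> T') (s : seq T) (F : T' -> K) :
  avg (map h s) F = avg s (F \o h).
Proof. by rewrite /avg big_map size_map. Qed.

Lemma avg_exchange (T T' : Type) (s : seq T) (s' : seq T') (F : T -> T' -> K) :
  avg s (fun a => avg s' (F a)) = avg s' (fun b => avg s (F^~ b)).
Proof. by rewrite /avg -!mulr_suml exchange_big /= mulrAC. Qed.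

Lemma avg_allpairs (T T' T'' : Type) (h : T -> T' -> T'') (s : seq T)
    (s' : seq T') (F : T'' -> K) :
  avg [seq h a b | a <- s, b <- s'] F =
  avg s (fun a => avg s' (fun b => F (h a b))).
Proof.
rewrite /avg big_allpairs_dep size_allpairs -mulr_suml -mulrA natrM invfM.
by rewrite [X in _ * X]mulrC.
Qed.

Lemma avg_norm (T : Type) (s : seq T) (F : T -> K) e :
  (0 < size s)%N -> (forall a, `|F a| <= e) -> `|avg s F| <= e.
Proof.
move=> s0 H; rewrite /avg normrM normfV normr_nat ler_pdivrMr ?ltr0n//.
rewrite (le_trans (ler_norm_sum _ _ _))// (le_trans (ler_sum _ (fun a _ => H a)))//.
by rewrite big_const_seq iter_addr_0 count_predT mulr_natr.
Qed.

Lemma avg_dist (T : Type) (s : seq T) (F : T -> K) c e :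
  (0 < size s)%N -> (forall a, `|F a - c| <= e) -> `|avg s F - c| <= e.
Proof.
by move=> s0 H; rewrite -{1}(avg_cst c s0) -avgB; exact: avg_norm.
Qed.

Lemma le_avg (T : Type) (s : seq T) (F F' : T -> K) :
  (forall a, F a <= F' a) -> avg s F <= avg s F'.
Proof. by move=> H; rewrite ler_wpM2r ?invr_ge0// ler_sum. Qed.

Lemma avg_ge (T : Type) (s : seq T) (F : T -> K) c :
  (0 < size s)%N -> (forall a, c <= F a) -> c <= avg s F.
Proof. by move=> s0 H; rewrite -(avg_cst c s0) le_avg. Qed.

Lemma avg_le (T : Type) (s : seq T) (F : T -> K) c :
  (0 < size s)%N -> (forall a, F a <= c) -> avg s F <= c.
Proof. by move=> s0 H; rewrite -(avg_cst c s0) le_avg. Qed.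

Lemma avg_le_drop (T : eqType) (s : seq T) (F : T -> K) c d a0 :
  a0 \in s -> (forall a, F a <= c) -> F a0 <= c - d ->
  avg s F <= c - d / (size s)%:R.
Proof.
move=> a0s H Ha0; have s0 : (0 < size s)%N by case: (s) a0s.
rewrite -(mulfK (_ : (size s)%:R != 0) c) ?pnatr_eq0 -?lt0n// -mulrBl.
rewrite ler_wpM2r ?invr_ge0// (perm_big _ (perm_to_rem a0s)) /= big_cons.
rewrite (perm_size (perm_to_rem a0s)) /= -addn1 natrD mulrDr mulr1.
rewrite [leLHS]addrC -addrA lerD//.
rewrite (le_trans (ler_sum _ (fun a _ => H a)))//.
by rewrite big_const_seq iter_addr_0 count_predT mulr_natr.
Qed.

End FiniteAverages.

Section ComplexAverages.
Variable R : realType.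
Local Notation C := R[i].
Local Notation normc := (@Normc.normc R).
Local Notation Re := (@complex.Re R).
Local Notation Im := (@complex.Im R).

Lemma Re_avg (T : Type) (s : seq T) (F : T -> C) :
  Re (avg s F) = avg s (fun a => Re (F a)).
Proof.
rewrite /avg -(rmorph_nat (real_complex R)) -fmorphV mulrC.
transitivity (((size s)%:R)^-1 * Re (\sum_(a <- s) F a)).
  by case: (\sum_(a <- s) F a) => a b /=; rewrite mul0r subr0.
by rewrite mulrC (raddf_sum (@complex.Re R : Rcomplex R -> R)).
Qed.

Lemma Im_avg (T : Type) (s : seq T) (F : T -> C) :
  Im (avg s F) = avg s (fun a => Im (F a)).
Proof.
rewrite /avg -(rmorph_nat (real_complex R)) -fmorphV mulrC.
transitivity (((size s)%:R)^-1 * Im (\sum_(a <- s) F a)).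
  by case: (\sum_(a <- s) F a) => a b /=; rewrite mul0r addr0.
by rewrite mulrC (raddf_sum (@complex.Im R : Rcomplex R -> R)).
Qed.

Lemma avg_conj (T : Type) (s : seq T) (F : T -> C) :
  ((avg s F)^*)%C = avg s (fun a => ((F a)^*)%C).
Proof. by rewrite /avg rmorphM rmorph_sum fmorphV rmorph_nat. Qed.

Lemma avg_normc (T : Type) (s : seq T) (F : T -> C) (e : R) :
  (0 < size s)%N -> (forall a, normc (F a) <= e) -> normc (avg s F) <= e.
Proof.
by move=> s0 H; rewrite -normc_le avg_norm// => a; rewrite normc_le.
Qed.

Lemma avg_distc (T : Type) (s : seq T) (F : T -> C) c (e : R) :
  (0 < size s)%N -> (forall a, normc (F a - c) <= e) -> normc (avg s F - c) <= e.
Proof.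
by move=> s0 H; rewrite -normc_le avg_dist// => a; rewrite normc_le.
Qed.

End ComplexAverages.

(** * Averages of translates with small oscillation *)

Section Oscillation.
Variables (R : realType) (G : compactGroupType).
Local Notation C := R[i].
Local Notation normc := (@Normc.normc R).
Local Notation Re := (@complex.Re R).
Local Notation Im := (@complex.Im R).

Lemma continuous_mulg2 (T : topologicalType) (f g : T -> G) :
  continuous f -> continuous g -> continuous (fun x => f x * g x)%g.
Proof.
move=> fc gc x.
apply: (@continuous_comp _ _ _ (fun x => (f x, g x)) (fun z : G * G => z.1 * z.2)%g);
  last exact: mulg_continuous.
by apply: cvg_pair; [exact: fc|exact: gc].
Qed.

Lemma continuous_invg (T : topologicalType) (f : T -> G) :
  continuous f -> continuous (fun x => (f x)^-1)%g.
Proof.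
move=> fc x.
by apply: (@continuous_comp _ _ _ f (fun z : G => z^-1)%g);
  [exact: fc|exact: invg_continuous].
Qed.

Lemma continuous_mulgl (a : G) : continuous (fun x => a * x)%g.
Proof. by apply: continuous_mulg2; [exact: cst_continuous|move=> x; exact: cvg_id]. Qed.

Lemma continuous_compT (T U V : topologicalType) (f : T -> U) (g : U -> V) :
  continuous f -> continuous g -> continuous (fun x => g (f x)).
Proof.
by move=> fc gc x; apply: (@continuous_comp _ _ _ f g); [exact: fc|exact: gc].
Qed.

Lemma translate_net (U : set G) : nbhs (1%g : G) U ->
  exists2 s : seq G, (0 < size s)%N & forall t, exists2 a, a \in s & U (a^-1 * t)%g.
Proof.
move=> U1.
have [a|s Hs] := @finite_net G (fun a t => U (a^-1 * t)%g) (@group_compact G).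
  have /(_ a) := @continuous_mulgl (a^-1)%g.
  by apply; rewrite mulVg.
by exists s => //; have [a] := Hs 1%g; case: (s).
Qed.

Lemma bounded_continuous (f : G -> C) : ccontinuous f ->
  exists M : R, forall t, normc (f t) <= M.
Proof.
by move=> /ccontinuousP fc; exists (supnorm (mkContFun fc)) => t;
  exact: (supnorm_ub (mkContFun fc)). Qed.

(* If [g] oscillates by more than [e], then near a point [y0] it stays [e/2]
   below its upper bound; averaging over the [n] translates [y0 * b^-1], [b]
   ranging over a net, lowers the upper bound by [(e/2)/n], and [n] depends
   only on the modulus of continuity, which averaging preserves. *)
Lemma avg_oscillation (f : G -> R) (e : R) : continuous f -> 0 < e ->
  exists2 s : seq G, (0 < size s)%N &
  forall x y, `|avg s (fun a => f (a * x)%g) - avg s (fun a => f (a * y)%g)| <= e.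
Proof.
move=> fc e0; have e20 : 0 < e / 2 by rewrite divr_gt0.
have fCc := ccontinuous_real fc.
have Fc : continuous (fun z : G * G => f (z.2 * z.1)%g).
  apply: (@continuous_compT _ _ _ (fun z : G * G => (z.2 * z.1)%g) f) => //.
  by apply: continuous_mulg2 => z; [exact: cvg_snd|exact: cvg_fst].
have [s s0 Hs] := translate_net (uniform_near_real (@group_compact G) Fc 1%g e20).
have {}Hs z (y : G) : exists2 b, b \in s &
    forall a, f (a * (y * b^-1 * z))%g <= f (a * y)%g + e / 2.
  have [b bs Hb] := Hs z; exists b => // a.
  have := Hb (a * y)%g; rewrite /= mulg1 !mulgA.
  by rewrite distrC => /ltW/ler_normlW; lra.
have [M HM] := bounded_continuous fCc.
have {}HM t : `|f t| <= M by rewrite -normc_real.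
set n := (size s)%:R : R.
have n0 : 0 < n by rewrite ltr0n.
(* Induction on the number [k] of rounds. The lower bound [- M] survives every round, so the second
   alternative fails once the total drop exceeds [2 * M]. *)
suff H (k : nat) : exists2 l : seq G, (0 < size l)%N &
    (forall x y, `|avg l (fun a => f (a * x)%g) - avg l (fun a => f (a * y)%g)| <= e)
    \/ forall x, - M <= avg l (fun a => f (a * x)%g) <= M - k%:R * (e / 2 / n).
  have [k Hk] : exists k : nat, 2 * M < k%:R * (e / 2 / n).
    exists (Num.bound `|2 * M / (e / 2 / n)|).
    rewrite -ltr_pdivrMr ?divr_gt0//; apply: le_lt_trans (ler_norm _) _.
    by apply: archi_boundP.
  have [l l0 [Hl|Hl]] := H k; first by exists l.
  by have := Hl 1%g; lra.
elim: k => [|k [l l0 [Hl|Hl]]]; last 2 first.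
- by exists l => //; left.
- set g := fun x => avg l (fun a => f (a * x)%g).
  have [?|] := pselect (forall x y, `|g x - g y| <= e).
    by exists l => //; left.
  move=> /existsNP [x1 /existsNP [y1 /negP]]; rewrite -ltNge => Hxy.
  have {x1 y1 Hxy} [x0 [y0 Hxy]] : exists x0 y0, e < g x0 - g y0.
    move: Hxy; rewrite ltr_normr => /orP[] ?; first by exists x1, y1.
    by exists y1, x1; lra.
  exists [seq (a * b)%g | b <- [seq y0 * b^-1 | b <- s]%g, a <- l].
    by rewrite size_allpairs muln_gt0 size_map s0.
  right => z.
  have -> : avg [seq (a * b)%g | b <- [seq y0 * b^-1 | b <- s]%g, a <- l]
       (fun a => f (a * z)%g) = avg s (fun b => g (y0 * b^-1 * z)%g).
    rewrite avg_allpairs avg_map; apply: eq_avg => b /=.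
    by apply: eq_avg => a; rewrite !mulgA.
  apply/andP; split; first by apply: avg_ge => // b; case/andP: (Hl (y0 * b^-1 * z)%g).
  have [b bs Hb] := Hs z y0.
  have -> : M - k.+1%:R * (e / 2 / n) = M - k%:R * (e / 2 / n) - e / 2 / n.
    by rewrite -natr1; ring.
  apply: (avg_le_drop bs) => [b'|].
    by case/andP: (Hl (y0 * b'^-1 * z)%g).
  have /andP[_ Hx0] := Hl x0.
  rewrite -/(g x0) in Hx0.
  suff : g (y0 * b^-1 * z)%g <= g y0 + e / 2 by lra.
  rewrite -(avg_cst (e / 2) l0) -avgD; exact: le_avg.
- exists [:: 1%g] => //; right => x; rewrite /avg big_seq1 /= mul1g divr1.
  by have := HM x; rewrite ler_norml; lra.
Qed.

End Oscillation.

(** * The invariant mean *)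

Section Mean.
Variables (R : realType) (G : compactGroupType).
Local Notation C := R[i].
Local Notation normc := (@Normc.normc R).
Local Notation Re := (@complex.Re R).
Local Notation Im := (@complex.Im R).
Implicit Types f g : G -> C.

Lemma ccontinuous_avg (T : topologicalType) (I : Type) (s : seq I)
    (F : I -> T -> C) :
  (forall a, ccontinuous (F a)) -> ccontinuous (fun x => avg s (F^~ x)).
Proof.
move=> Fc; rewrite /avg; apply: ccontinuousM; last exact: ccontinuous_cst.
exact: ccontinuous_sum.
Qed.

Lemma ccontinuous_lmul (f : G -> C) a :
  ccontinuous f -> ccontinuous (fun x => f (a * x)%g).
Proof. by move=> fc; apply: ccontinuous_comp fc; exact: continuous_mulgl. Qed.

Lemma ccontinuous_inv (f : G -> C) :
  ccontinuous f -> ccontinuous (fun x => f x^-1%g).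
Proof. by move=> fc; apply: ccontinuous_comp fc; exact: invg_continuous. Qed.

(** The averaging for the imaginary part is applied to the already averaged [g]; averaging once more
    does not increase the oscillation of the real part. *)
Lemma avg_oscillationC f (e : R) : ccontinuous f -> 0 < e ->
  exists2 s : seq G, (0 < size s)%N & forall x y,
    normc (avg s (fun a => f (a * x)%g) - avg s (fun a => f (a * y)%g)) <= e.
Proof.
move=> fc e0; have e20 : 0 < e / 2 by rewrite divr_gt0.
have [s s0 Hs] := avg_oscillation (continuous_Re fc) e20.
pose g x := avg s (fun a => f (a * x)%g).
have gc : ccontinuous g.
  by apply: ccontinuous_avg => a; exact: ccontinuous_lmul.
have [t t0 Ht] := avg_oscillation (continuous_Im gc) e20.
exists [seq (a * b)%g | b <- t, a <- s]; first by rewrite size_allpairs muln_gt0 t0.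
have E z : avg [seq (a * b)%g | b <- t, a <- s] (fun a => f (a * z)%g) =
    avg t (fun b => g (b * z)%g).
  by rewrite avg_allpairs; apply: eq_avg => b; apply: eq_avg => a; rewrite mulgA.
move=> x y; rewrite !E (le_trans (normc_ReIm _))// [leRHS]splitr.
rewrite !raddfB /= !Re_avg !Im_avg lerD//.
rewrite -avgB avg_norm// => b; rewrite !Re_avg; exact: Hs.
Qed.

Lemma right_avg_oscillationC f (e : R) : ccontinuous f -> 0 < e ->
  exists2 s : seq G, (0 < size s)%N & forall x y,
    normc (avg s (fun a => f (x * a)%g) - avg s (fun a => f (y * a)%g)) <= e.
Proof.
move=> fc e0; have [s s0 Hs] := avg_oscillationC (ccontinuous_inv fc) e0.
exists (map (fun a : G => a^-1)%g s); first by rewrite size_map.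
have E z : avg (map (fun a : G => a^-1)%g s) (fun a => f (z * a)%g) =
    avg s (fun a => f (a * z^-1)^-1%g).
  by rewrite avg_map; apply: eq_avg => a /=; rewrite invgM invgK.
by move=> x y; rewrite !E; exact: Hs.
Qed.

(** The double average [z] is at once an average of left averages and an average of right averages,
    so it lies near both. *)
Lemma avg_cross (K : numFieldType) (f : G -> K) s s' e e' :
  (0 < size s)%N -> (0 < size s')%N ->
  (forall x y, `|avg s (fun a => f (a * x)%g) - avg s (fun a => f (a * y)%g)| <= e) ->
  (forall x y, `|avg s' (fun a => f (x * a)%g) - avg s' (fun a => f (y * a)%g)| <= e') ->
  forall x y, `|avg s (fun a => f (a * x)%g) - avg s' (fun a => f (y * a)%g)| <= e + e'.
Proof.
move=> s0 s0' He He' x y.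
pose z := avg s' (fun b => avg s (fun a => f (a * b)%g)).
rewrite -(subrKA z) (le_trans (ler_normD _ _))// lerD//.
  by rewrite distrC avg_dist.
by rewrite /z -avg_exchange avg_dist.
Qed.

Definition left_mean f (c : C) := forall e : R, 0 < e ->
  exists2 s : seq G, (0 < size s)%N &
    forall x, normc (avg s (fun a => f (a * x)%g) - c) <= e.

Definition right_mean f (c : C) := forall e : R, 0 < e ->
  exists2 s : seq G, (0 < size s)%N &
    forall x, normc (avg s (fun a => f (x * a)%g) - c) <= e.

Lemma eq0_normc_le (z : C) : (forall e : R, 0 < e -> normc z <= e) -> z = 0.
Proof.
move=> H; apply: Normc.eq0_normc; apply/eqP; rewrite eq_le normc_ge0 andbT.
by apply/ler_addgt0Pr => e e0; rewrite add0r; exact: H.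
Qed.

(** The same double average as in [avg_cross]. Once both kinds of mean exist, this makes each of
    them unique, so a later computation of [mean] needs one side only. *)
Lemma left_right_mean f c d : left_mean f c -> right_mean f d -> c = d.
Proof.
move=> Hc Hd; apply/eqP; rewrite -subr_eq0; apply/eqP/eq0_normc_le => e e0.
have e20 : 0 < e / 2 by rewrite divr_gt0.
have [s s0 Hs] := Hc _ e20; have [s' s0' Hs'] := Hd _ e20.
pose z := avg s' (fun b => avg s (fun a => f (a * b)%g)).
rewrite -(subrKA z) (le_trans (le_normcD _ _))// [leRHS]splitr lerD//.
  by rewrite normc_distC avg_distc.
by rewrite /z -avg_exchange avg_distc.
Qed.

Let low (f : G -> R) : set R := [set a | exists2 s : seq G, (0 < size s)%N &
  forall x, a <= avg s (fun b => f (b * x)%g)].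

Let left_osc (f : G -> R) (s : seq G) (e : R) := forall x y,
  `|avg s (fun a => f (a * x)%g) - avg s (fun a => f (a * y)%g)| <= e.

Let right_osc (f : G -> R) (s : seq G) (e : R) := forall x y,
  `|avg s (fun a => f (x * a)%g) - avg s (fun a => f (y * a)%g)| <= e.

(** The constant is the supremum of [low f], the lower bounds of left averages. By the double
    average, an upper bound of any right average bounds [low f] from above; lists of small
    oscillation on either side then squeeze the supremum. *)
Lemma real_mean_exists (f : G -> R) (M : R) :
  (forall x, `|f x| <= M) ->
  (forall e, 0 < e -> exists2 s : seq G, (0 < size s)%N & left_osc f s e) ->
  (forall e, 0 < e -> exists2 s : seq G, (0 < size s)%N & right_osc f s e) ->
  exists c, forall (s : seq G) e, (0 < size s)%N ->
  (left_osc f s e -> forall x, `|avg s (fun a => f (a * x)%g) - c| <= e) /\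
  (right_osc f s e -> forall x, `|avg s (fun a => f (x * a)%g) - c| <= e).
Proof.
move=> fM HL HR.
have lowne : low f !=set0.
  exists (- M); exists [:: 1%g] => // x; apply: avg_ge => // a.
  by have := fM (a * x)%g; rewrite ler_norml => /andP[].
have lowub s B : (0 < size s)%N -> (forall x, avg s (fun a => f (x * a)%g) <= B) ->
    ubound (low f) B.
  move=> s0 HB a [t t0 Ht].
  apply: (@le_trans _ _ (avg s (fun b => avg t (fun a => f (a * b)%g)))).
    exact: avg_ge.
  by rewrite -avg_exchange; exact: avg_le.
have lowhub : has_ubound (low f).
  exists M; apply: (lowub [:: 1%g]) => // x; apply: avg_le => // a.
  by have := fM (x * a)%g; rewrite ler_norml => /andP[].
have low_le a : low f a -> a <= sup (low f) by exact: ub_le_sup.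
have ge_low B : ubound (low f) B -> sup (low f) <= B by exact: ge_sup.
exists (sup (low f)) => s e s0; split=> H x; rewrite ler_norml; apply/andP; split.
- rewrite lerBrDl lerBlDr; apply/ler_addgt0Pr => e' e0'.
  have [t t0 Ht] := HR _ e0'.
  apply: ge_low; apply: (lowub t) => // y.
  by have := avg_cross s0 t0 H Ht x y; rewrite ler_norml; lra.
- rewrite lerBlDl -lerBlDr; apply: low_le; exists s => // y.
  by have := H x y; rewrite ler_norml; lra.
- rewrite lerBrDl lerBlDr; apply: ge_low; apply: (lowub s) => // y.
  by have := H x y; rewrite ler_norml; lra.
- rewrite lerBlDl; apply/ler_addgt0Pr => e' e0'.
  have [t t0 Ht] := HL _ e0'.
  rewrite -addrA -lerBlDr; apply: low_le; exists t => // y.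
  by have := avg_cross t0 s0 Ht H y x; rewrite ler_norml; lra.
Qed.

Lemma mean_exists f : ccontinuous f -> exists c, left_mean f c /\ right_mean f c.
Proof.
move=> fc; have [M HM] := bounded_continuous fc.
have [|||c1 Hc1] := @real_mean_exists (fun x => Re (f x)) M.
- by move=> x; rewrite (le_trans (normc_Re _)).
- move=> e e0; have [s s0 Hs] := avg_oscillationC fc e0; exists s => // x y.
  by rewrite -!Re_avg -raddfB (le_trans (normc_Re _)).
- move=> e e0; have [s s0 Hs] := right_avg_oscillationC fc e0; exists s => // x y.
  by rewrite -!Re_avg -raddfB (le_trans (normc_Re _)).
have [|||c2 Hc2] := @real_mean_exists (fun x => Im (f x)) M.
- by move=> x; rewrite (le_trans (normc_Im _)).
- move=> e e0; have [s s0 Hs] := avg_oscillationC fc e0; exists s => // x y.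
  by rewrite -!Im_avg -raddfB (le_trans (normc_Im _)).
- move=> e e0; have [s s0 Hs] := right_avg_oscillationC fc e0; exists s => // x y.
  by rewrite -!Im_avg -raddfB (le_trans (normc_Im _)).
exists (c1 +i* c2)%C; split=> e e0; have e20 : 0 < e / 2 by rewrite divr_gt0.
- have [s s0 Hs] := avg_oscillationC fc e20; exists s => // x.
  rewrite (le_trans (normc_ReIm _))// !raddfB /= Re_avg Im_avg [leRHS]splitr lerD//.
    apply: (Hc1 s (e / 2) s0).1 => y z.
    by rewrite -!Re_avg -raddfB (le_trans (normc_Re _)).
  apply: (Hc2 s (e / 2) s0).1 => y z.
  by rewrite -!Im_avg -raddfB (le_trans (normc_Im _)).
- have [s s0 Hs] := right_avg_oscillationC fc e20; exists s => // x.
  rewrite (le_trans (normc_ReIm _))// !raddfB /= Re_avg Im_avg [leRHS]splitr lerD//.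
    apply: (Hc1 s (e / 2) s0).2 => y z.
    by rewrite -!Re_avg -raddfB (le_trans (normc_Re _)).
  apply: (Hc2 s (e / 2) s0).2 => y z.
  by rewrite -!Im_avg -raddfB (le_trans (normc_Im _)).
Qed.

(* Locked: unification would otherwise unfold [mean] and diverge. *)
Fact mean_key : unit. Proof. by []. Qed.

Definition mean f : C :=
  locked_with mean_key (xget 0 [set c | left_mean f c /\ right_mean f c]).

Lemma meanP f : ccontinuous f -> left_mean f (mean f) /\ right_mean f (mean f).
Proof.
rewrite /mean locked_withE => /mean_exists.
exact: (@xgetPex _ 0 [set c | left_mean f c /\ right_mean f c]).
Qed.

Lemma left_meanE f c : ccontinuous f -> left_mean f c -> mean f = c.
Proof. by move=> /meanP[_ H] /left_right_mean /(_ H). Qed.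

Lemma right_meanE f c : ccontinuous f -> right_mean f c -> mean f = c.
Proof. by move=> /meanP[H _] /(left_right_mean H). Qed.

End Mean.

(** * Linearity, invariance, positivity and Fubini for the mean *)

Section MeanTheory.
Variables (R : realType) (G : compactGroupType).
Local Notation C := R[i].
Local Notation normc := (@Normc.normc R).
Local Notation Re := (@complex.Re R).
Local Notation Im := (@complex.Im R).
Implicit Types f g : G -> C.

Lemma eq_mean f g : f =1 g -> mean f = mean g.
Proof. by move=> /funext ->. Qed.

Lemma mean_cst (c : C) : mean (fun _ : G => c) = c :> C.
Proof.
apply: left_meanE => [|e e0]; first exact: ccontinuous_cst.
by exists [:: 1%g : G] => // x; rewrite avg_cst// subrr Normc.normc0 ltW.
Qed.

(** Right averages commute with left translation, so they approach the same constant; hence the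
    proof through [right_meanE]. *)
Lemma mean_lmul f a : ccontinuous f -> mean (fun x => f (a * x)%g) = mean f.
Proof.
move=> fc; apply: right_meanE => [|e e0]; first exact: ccontinuous_lmul.
have [s s0 Hs] := (meanP fc).2 _ e0; exists s => // x.
by under eq_avg => b do rewrite mulgA; exact: Hs.
Qed.

Lemma mean_inv f : ccontinuous f -> mean (fun x => f x^-1%g) = mean f.
Proof.
move=> fc; apply: right_meanE => [|e e0]; first exact: ccontinuous_inv.
have [s s0 Hs] := (meanP fc).1 _ e0.
exists (map (fun a : G => a^-1)%g s); first by rewrite size_map.
move=> x; have := Hs x^-1%g; congr (normc (_ - _) <= _).
by rewrite avg_map; apply: eq_avg => b /=; rewrite invgM invgK.
Qed.

Lemma mean_conj f : ccontinuous f -> mean (fun x => ((f x)^*)%C) = ((mean f)^*)%C.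
Proof.
move=> fc; apply: left_meanE => [|e e0]; first exact: ccontinuous_conj.
have [s s0 Hs] := (meanP fc).1 _ e0; exists s => // x.
by rewrite -avg_conj -rmorphB normc_conj.
Qed.

Lemma meanZ (c : C) f : ccontinuous f -> mean (fun x => c * f x) = c * mean f.
Proof.
move=> fc; apply: left_meanE => [|e e0].
  by apply: ccontinuousM fc; exact: ccontinuous_cst.
have k0 : 0 < normc c + 1 by have := normc_ge0 c; lra.
have ek0 : 0 < e / (normc c + 1) by rewrite divr_gt0.
have [s s0 Hs] := (meanP fc).1 _ ek0; exists s => // x.
rewrite avgZ -mulrBr Normc.normcM.
apply: (@le_trans _ _ ((normc c + 1) * (e / (normc c + 1)))); last first.
  by rewrite mulrCA divff ?mulr1// gt_eqF.
by rewrite ler_pM ?normc_ge0// lerDl.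
Qed.

Lemma mean_avgl f (s : seq G) : ccontinuous f -> (0 < size s)%N ->
  mean (fun x => avg s (fun a => f (a * x)%g)) = mean f.
Proof.
move=> fc s0; apply: right_meanE => [|e e0].
  by apply: ccontinuous_avg => a; exact: ccontinuous_lmul.
have [t t0 Ht] := (meanP fc).2 _ e0; exists t => // x.
rewrite -avg_exchange; apply: avg_distc => // a.
by under eq_avg => b do rewrite mulgA; exact: Ht.
Qed.

(** Averages the average over [s] once more; by [mean_avgl] it has the same mean. With
    [left_mean_coarsen], one list can serve several functions, as additivity of the mean
    requires. *)
Lemma left_mean_refine f (s : seq G) (e : R) : ccontinuous f -> (0 < size s)%N -> 0 < e ->
  exists2 t : seq G, (0 < size t)%N & forall x,
  normc (avg [seq (a * b)%g | b <- t, a <- s] (fun a => f (a * x)%g) - mean f) <= e.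
Proof.
move=> fc s0 e0.
have gc : ccontinuous (fun x => avg s (fun a => f (a * x)%g)).
  by apply: ccontinuous_avg => a; exact: ccontinuous_lmul.
have [t t0 Ht] := (meanP gc).1 _ e0; exists t; first exact: t0.
move=> x; rewrite -(mean_avgl fc s0); have := Ht x; congr (normc (_ - _) <= _).
by rewrite avg_allpairs; apply: eq_avg => b; apply: eq_avg => a; rewrite mulgA.
Qed.

Lemma left_mean_coarsen f (s t : seq G) c (e : R) : (0 < size t)%N ->
  (forall x, normc (avg s (fun a => f (a * x)%g) - c) <= e) -> forall x,
  normc (avg [seq (a * b)%g | b <- t, a <- s] (fun a => f (a * x)%g) - c) <= e.
Proof.
move=> t0 H x; rewrite avg_allpairs; apply: avg_distc => // b.
by under eq_avg => a do rewrite -mulgA; exact: H.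
Qed.

Lemma meanD f g : ccontinuous f -> ccontinuous g ->
  mean (fun x => f x + g x) = mean f + mean g.
Proof.
move=> fc gc; apply: left_meanE => [|e e0]; first exact: ccontinuousD.
have e20 : 0 < e / 2 by rewrite divr_gt0.
have [s s0 Hs] := (meanP fc).1 _ e20.
have [t t0 Ht] := left_mean_refine gc s0 e20.
exists [seq (a * b)%g | b <- t, a <- s]; first by rewrite size_allpairs muln_gt0 t0.
move=> x; rewrite avgD opprD addrACA (le_trans (le_normcD _ _))// [leRHS]splitr.
apply: lerD.
- exact: (left_mean_coarsen t0 Hs).
- exact: Ht.
Qed.

Lemma meanN f : ccontinuous f -> mean (fun x => - f x) = - mean f.
Proof.
move=> fc; rewrite -mulN1r -(meanZ _ fc); apply: eq_mean => x.
by rewrite mulN1r.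
Qed.

Lemma meanB f g : ccontinuous f -> ccontinuous g ->
  mean (fun x => f x - g x) = mean f - mean g.
Proof.
move=> fc gc; by rewrite -(meanN gc) -(meanD fc (ccontinuousN gc)).
Qed.

Lemma mean_Re_ge f (d : R) : ccontinuous f -> (forall x, d <= Re (f x)) ->
  d <= Re (mean f).
Proof.
move=> fc H; apply/ler_addgt0Pr => e e0.
have [s s0 Hs] := (meanP fc).1 _ e0.
have := le_trans (normc_Re _) (Hs 1%g); rewrite raddfB /= Re_avg ler_norml => /andP[_].
have : d <= avg s (fun a => Re (f (a * 1)%g)) by exact: avg_ge.
lra.
Qed.

Lemma mean_real f : ccontinuous f -> (forall x, Im (f x) = 0) -> Im (mean f) = 0.
Proof.
move=> fc H; have : ((mean f)^*)%C = mean f.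
  rewrite -(mean_conj fc); apply: eq_mean => x.
  by have := H x; case: (f x) => a b /= ->; rewrite oppr0.
case: (mean f) => a b /= [] /eqP.
by rewrite -subr_eq0 -opprD oppr_eq0 -mulr2n mulrn_eq0 => /eqP.
Qed.

Lemma mean_normc f (M : R) : ccontinuous f -> (forall x, normc (f x) <= M) ->
  normc (mean f) <= M.
Proof.
move=> fc H; apply/ler_addgt0Pr => e e0.
have [s s0 Hs] := (meanP fc).1 _ e0.
rewrite -[mean f](subrK (avg s (fun a => f (a * 1)%g))).
rewrite (le_trans (le_normcD _ _))// addrC lerD//; first exact: avg_normc.
by rewrite normc_distC.
Qed.

(** [Re f] is at least [d = Re (f x0) / 2] on a neighbourhood [x0 U]. Finitely many translates of it
    cover the group, so an average of [n] translates of [f], with the same mean, has real part at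
    least [d / n] everywhere. This gives definiteness of the inner product. *)
Lemma mean_gt0 f x0 : ccontinuous f -> (forall x, 0 <= Re (f x)) ->
  0 < Re (f x0) -> 0 < Re (mean f).
Proof.
move=> fc f0 fx0; have d0 : 0 < Re (f x0) / 2 by rewrite divr_gt0.
pose U : set G := [set u | Re (f x0) / 2 <= Re (f (x0 * u)%g)].
have [|s s0 Hs] := @translate_net G U.
  have /(_ 1%g) := continuous_Re (ccontinuous_lmul x0 fc).
  move=> /(@cvgr_dist_lt R R^o _ _ (nbhs_filter _)) /(_ _ d0).
  by apply: filterS => u; rewrite /U /= mulg1 => /ltW/ler_normlW; lra.
pose t := [seq (x0 * b^-1)%g | b <- s].
have t0 : (0 < size t)%N by rewrite size_map.
rewrite -(mean_avgl fc t0).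
have n0 : 0 < (size t)%:R :> R by rewrite ltr0n.
apply: (@lt_le_trans _ _ (Re (f x0) / 2 / (size t)%:R)); first by rewrite divr_gt0.
apply: mean_Re_ge => [|x].
  by apply: ccontinuous_avg => a; exact: ccontinuous_lmul.
rewrite Re_avg; have [b bs Ub] := Hs x.
have bt : (x0 * b^-1)%g \in t by apply/mapP; exists b.
(* [avg_le_drop] is applied to the negatives, whose upper bound is [0]. *)
rewrite -lerN2 -avgN -[leRHS]sub0r.
apply: (avg_le_drop bt) => [a|]; first by rewrite oppr_le0.
by rewrite sub0r lerN2 -mulgA.
Qed.

Lemma ccontinuous_pairl (T U : topologicalType) (F : T * U -> C) u :
  ccontinuous F -> ccontinuous (fun t => F (t, u)).
Proof.
move=> Fc; apply: (ccontinuous_comp (f := fun t => (t, u)) _ Fc) => t.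
by apply: cvg_pair; [exact: cvg_id|exact: cvg_cst].
Qed.

Lemma ccontinuous_pairr (T U : topologicalType) (F : T * U -> C) t :
  ccontinuous F -> ccontinuous (fun u => F (t, u)).
Proof.
move=> Fc; apply: (ccontinuous_comp (f := fun u => (t, u)) _ Fc) => u.
by apply: cvg_pair; [exact: cvg_cst|exact: cvg_id].
Qed.

Lemma mean_continuous (T : topologicalType) (F : T * G -> C) : ccontinuous F ->
  ccontinuous (fun t => mean (fun x => F (t, x))).
Proof.
move=> Fc t e e0.
have e20 : 0 < e / 2 by rewrite divr_gt0.
have := uniform_near (@group_compact G) Fc t e20; apply: filterS => t' H.
rewrite -meanB; [|exact: ccontinuous_pairr..].
apply: (@le_lt_trans _ _ (e / 2)); last by lra.
apply: mean_normc => [|x]; last exact: ltW.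
by apply: ccontinuousB; exact: ccontinuous_pairr.
Qed.

Lemma left_mean_seq (I : eqType) (l : seq I) (F : I -> G -> C) (e : R) :
  (forall i, ccontinuous (F i)) -> 0 < e ->
  exists2 s : seq G, (0 < size s)%N & forall i x, i \in l ->
    normc (avg s (fun a => F i (a * x)%g) - mean (F i)) <= e.
Proof.
move=> Fc e0; elim: l => [|j l [s s0 Hs]]; first by exists [:: 1%g].
have [t t0 Ht] := left_mean_refine (Fc j) s0 e0.
exists [seq (a * b)%g | b <- t, a <- s]; first by rewrite size_allpairs muln_gt0 t0.
move=> i x; rewrite inE => /orP[/eqP ->|il]; first exact: Ht.
by apply: (left_mean_coarsen t0) => y; exact: Hs.
Qed.

(** [left_mean_seq] handles a finite net of parameters; the three thirds pay for moving from [t] to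
    the net, for the approximation there, and for moving back. *)
Lemma uniform_left_mean (F : G * G -> C) (e : R) : ccontinuous F -> 0 < e ->
  exists2 s : seq G, (0 < size s)%N & forall t x,
    normc (avg s (fun a => F (t, a * x)%g) - mean (fun u => F (t, u))) <= e.
Proof.
move=> Fc e0; have e30 : 0 < e / 3 by rewrite divr_gt0.
have [l Hl] := finite_net (@group_compact G)
  (fun t => uniform_near (@group_compact G) Fc t e30).
have [s s0 Hs] := left_mean_seq l (fun t => @ccontinuous_pairr _ _ F t Fc) e30.
exists s => // t x; have [t' t'l Ht] := Hl t.
have E : e = e / 3 + (e / 3 + e / 3) by field.
rewrite -(subrKA (avg s (fun a => F (t', a * x)%g))) (le_trans (le_normcD _ _))//.
rewrite {1}E lerD//.
  by rewrite -avgB avg_normc// => a; rewrite normc_distC ltW.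
rewrite -(subrKA (mean (fun u => F (t', u)))) (le_trans (le_normcD _ _))// lerD//.
  exact: Hs.
rewrite -meanB; [|exact: ccontinuous_pairr..].
apply: mean_normc => [|y]; last exact: ltW.
by apply: ccontinuousB; exact: ccontinuous_pairr.
Qed.

Lemma mean_sum (I : Type) (s : seq I) (F : I -> G -> C) :
  (forall i, ccontinuous (F i)) ->
  mean (fun x => \sum_(i <- s) F i x) = \sum_(i <- s) mean (F i) :> C.
Proof.
move=> Fc; elim: s => [|a s IH].
  by under eq_fun do rewrite big_nil; rewrite big_nil mean_cst.
under eq_fun do rewrite big_cons.
by rewrite big_cons meanD ?IH//; exact: ccontinuous_sum.
Qed.

Lemma mean_avg (I : Type) (s : seq I) (F : I -> G -> C) :
  (forall i, ccontinuous (F i)) ->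
  mean (fun x => avg s (F^~ x)) = avg s (fun i => mean (F i)).
Proof.
move=> Fc; rewrite /avg mulrC -(mean_sum s Fc) -(meanZ _ (ccontinuous_sum s Fc)).
by apply: eq_mean => x; rewrite mulrC.
Qed.

(** By [uniform_left_mean] the inner mean is a uniform limit of finite averages, and the outer mean
    passes through a finite average. *)
Lemma mean_exchange (F : G * G -> C) : ccontinuous F ->
  mean (fun x => mean (fun y => F (x, y))) =
  mean (fun y => mean (fun x => F (x, y))).
Proof.
move=> Fc; have F'c : ccontinuous (fun z : G * G => F (z.2, z.1)).
  apply: (ccontinuous_comp (f := fun z : G * G => (z.2, z.1)) _ Fc) => z.
  by apply: cvg_pair; [exact: cvg_snd|exact: cvg_fst].
have c1 := mean_continuous Fc; have c2 := mean_continuous F'c.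
apply/esym/left_meanE => // e e0.
have [s s0 Hs] := uniform_left_mean Fc e0; exists s => // y.
rewrite -(@mean_avg _ _ (fun a x => F (x, a * y)%g)); last first.
  by move=> a; exact: (@ccontinuous_pairl _ _ F).
have c3 : ccontinuous (fun x => avg s (fun a => F (x, a * y)%g)).
  by apply: ccontinuous_avg => a; exact: (@ccontinuous_pairl _ _ F).
rewrite -(meanB c3 c1); apply: mean_normc => [|x]; last exact: Hs.
exact: ccontinuousB.
Qed.

End MeanTheory.

(** * The inner product on C(G) *)

Section InnerProductSpace.
Variables (R : realType) (G : compactGroupType).
Local Notation C := R[i].
Local Notation CG := (contFun R G).
Local Notation normc := (@Normc.normc R).
Local Notation Re := (@complex.Re R).
Local Notation Im := (@complex.Im R).
Implicit Types f g h : CG.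

Lemma contFunP f g : (forall t, f t = g t) -> f = g.
Proof. by move=> H; apply/val_inj/funext. Qed.

Lemma contFunD f g t : (f + g) t = f t + g t :> C. Proof. by []. Qed.
Lemma contFunB f g t : (f - g) t = f t - g t :> C. Proof. by []. Qed.
Lemma contFunZ (a : C) f t : (a *: f) t = a * f t :> C. Proof. by []. Qed.

Lemma contFun_sum (I : Type) (s : seq I) (F : I -> CG) t :
  (\sum_(i <- s) F i) t = \sum_(i <- s) F i t :> C.
Proof.
elim: s => [|i s IH]; first by rewrite !big_nil.
by rewrite !big_cons contFunD IH.
Qed.

Lemma contFun_ccontinuous f : ccontinuous (f : G -> C).
Proof. by apply/ccontinuousP => t; exact: contFun_continuous. Qed.

Definition ccFun (f : G -> C) (fc : ccontinuous f) : CG :=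
  mkContFun ((ccontinuousP f).1 fc).

Lemma contFun_norm f : `|f| = (supnorm f)%:C%C :> C. Proof. by []. Qed.

Lemma closure_approx (A : set CG) f :
  (forall e : R, 0 < e -> exists2 g, A g & forall t, normc (f t - g t) <= e) ->
  closure A f.
Proof.
move=> H B /nbhs_ballP[e /= e0 He].
have eE : e = (Re e)%:C%C by rewrite RRe_real// gtr0_real.
have e0' : 0 < Re e / 2 by rewrite divr_gt0// -ltcR -eE.
have [g Ag Hg] := H _ e0'; exists g; split=> //; apply: He.
rewrite -ball_normE /ball_ /= contFun_norm eE ltcR.
apply: (@le_lt_trans _ _ (Re e / 2)); last by lra.
exact: supnorm_le.
Qed.

Lemma approx_closure (A : set CG) f (e : R) : closure A f -> 0 < e ->
  exists2 g, A g & forall t, normc (f t - g t) <= e.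
Proof.
move=> Af e0; have e0' : 0 < e%:C%C :> C by rewrite ltcR.
have [g [Ag]] := Af _ (nbhsx_ballx f _ e0').
rewrite -ball_normE /ball_ /= contFun_norm ltcR => H; exists g => // t.
exact: (le_trans (supnorm_ub (f - g) t) (ltW H)).
Qed.

Lemma closed_approx (X : set CG) f : closed X ->
  (forall e : R, 0 < e -> exists2 g, X g & forall t, normc (f t - g t) <= e) ->
  X f.
Proof. by move=> Xc /closure_approx; rewrite -((closure_id X).1 Xc). Qed.

Fact ip_key : unit. Proof. by []. Qed.

Definition ip f g : C := locked_with ip_key (mean (fun x => f x * ((g x)^*)%C)).

Lemma ipE f g : ip f g = mean (fun x => f x * ((g x)^*)%C).
Proof. by rewrite /ip locked_withE. Qed.

Let prod_cc f g : ccontinuous (fun x => f x * ((g x)^*)%C).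
Proof.
exact: (ccontinuousM (contFun_ccontinuous f) (ccontinuous_conj (contFun_ccontinuous g))).
Qed.

Lemma ipDl f g h : ip (f + g) h = ip f h + ip g h.
Proof.
rewrite !ipE -(meanD (prod_cc f h) (prod_cc g h)); apply: eq_mean => x.
by rewrite contFunD mulrDl.
Qed.

Lemma ipZl a f h : ip (a *: f) h = a * ip f h.
Proof.
rewrite !ipE -(meanZ _ (prod_cc f h)); apply: eq_mean => x.
by rewrite contFunZ mulrA.
Qed.

Lemma ipC f g : ip g f = ((ip f g)^*)%C.
Proof.
rewrite !ipE -(mean_conj (prod_cc f g)); apply: eq_mean => x.
by rewrite rmorphM /= conjcK mulrC.
Qed.

Lemma ip0l h : ip 0 h = 0.
Proof. by rewrite -(scale0r (0 : CG)) ipZl mul0r. Qed.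

Lemma ipNl f h : ip (- f) h = - ip f h.
Proof. by rewrite -scaleN1r ipZl mulN1r. Qed.

Lemma ipBl f g h : ip (f - g) h = ip f h - ip g h.
Proof. by rewrite ipDl ipNl. Qed.

Lemma ipDr f g h : ip h (f + g) = ip h f + ip h g.
Proof. by rewrite !(ipC _ h) ipDl rmorphD. Qed.

Lemma ipNr f h : ip h (- f) = - ip h f.
Proof. by rewrite !(ipC _ h) ipNl rmorphN. Qed.

Lemma ipBr f g h : ip h (f - g) = ip h f - ip h g.
Proof. by rewrite !(ipC _ h) ipBl rmorphB. Qed.

Lemma ipZr (a : C) f h : ip h (a *: f) = (a^*)%C * ip h f.
Proof. by rewrite !(ipC _ h) ipZl rmorphM. Qed.

Lemma ip0r h : ip h 0 = 0.
Proof. by rewrite ipC ip0l conjc0. Qed.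

Lemma ip_suml (I : Type) (s : seq I) (F : I -> CG) h :
  ip (\sum_(i <- s) F i) h = \sum_(i <- s) ip (F i) h.
Proof.
elim: s => [|i s IH]; first by rewrite !big_nil ip0l.
by rewrite !big_cons ipDl IH.
Qed.

Lemma ip_sumr (I : Type) (s : seq I) (F : I -> CG) h :
  ip h (\sum_(i <- s) F i) = \sum_(i <- s) ip h (F i).
Proof.
elim: s => [|i s IH]; first by rewrite !big_nil ip0r.
by rewrite !big_cons ipDr IH.
Qed.

Definition sqn f : R := Re (ip f f).

Lemma mul_conj (z : C) : z * (z^*)%C = (normc z ^+ 2)%:C%C.
Proof. by rewrite -sqr_normc rmorphXn. Qed.

Lemma ip_sqn f : ip f f = (sqn f)%:C%C.
Proof.
rewrite /sqn RRe_real//; apply/complex_realP; exists (Re (ip f f)).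
have : Im (ip f f) = 0.
  by rewrite ipE; apply: mean_real => [|x]; [exact: prod_cc|rewrite mul_conj].
by case: (ip f f) => a b /= ->.
Qed.

Lemma sqn_ge0 f : 0 <= sqn f.
Proof.
rewrite /sqn ipE; apply: mean_Re_ge => [|x]; first exact: prod_cc.
by rewrite mul_conj /= sqr_ge0.
Qed.

Lemma sqn_eq0 f : sqn f = 0 -> f = 0.
Proof.
move=> f0; apply: contrapT => fn0.
have [t ft] : exists t, f t <> 0.
  by apply/existsNP => H; apply: fn0; apply: contFunP => t; rewrite H.
have : 0 < sqn f.
  rewrite /sqn ipE; apply: (@mean_gt0 _ _ _ t) => [|x|]; first exact: prod_cc.
    by rewrite mul_conj /= sqr_ge0.
  rewrite mul_conj /= exprn_gt0// lt_def normc_ge0 andbT.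
  by apply/eqP => /Normc.eq0_normc.
by rewrite f0 ltxx.
Qed.

Lemma mean_Re_le (f : G -> C) (d : R) : ccontinuous f -> (forall x, Re (f x) <= d) ->
  Re (mean f) <= d.
Proof.
move=> fc H; rewrite -lerN2 -raddfN -(meanN fc); apply: mean_Re_ge => [|x].
  exact: ccontinuousN.
by rewrite raddfN lerN2; exact: H.
Qed.

Lemma sqn_le f (M : R) : (forall x, normc (f x) <= M) -> sqn f <= M ^+ 2.
Proof.
move=> H; rewrite /sqn ipE; apply: mean_Re_le => [|x]; first exact: prod_cc.
by rewrite mul_conj /= lerXn2r ?nnegrE ?normc_ge0// (le_trans (normc_ge0 (f x))).
Qed.

Lemma sqnZ (a : C) f : sqn (a *: f) = normc a ^+ 2 * sqn f.
Proof.
apply: complexI; rewrite -ip_sqn ipZl ipZr mulrA mul_conj ip_sqn.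
by rewrite [RHS]rmorphM; reflexivity.
Qed.

Lemma sqn0 : sqn 0 = 0.
Proof. by rewrite /sqn ip0l. Qed.

Lemma sqnD f g : sqn (f + g) = sqn f + 2 * Re (ip f g) + sqn g.
Proof.
rewrite /sqn ipDl !ipDr (ipC f g).
by case: (ip f g) (ip f f) (ip g g) => [a b] [c c'] [d d'] /=; ring.
Qed.

Lemma sqnN f : sqn (- f) = sqn f.
Proof. by rewrite -scaleN1r sqnZ normcN Normc.normc1 expr1n mul1r. Qed.

Lemma sqnB f g : sqn (f - g) = sqn f - 2 * Re (ip f g) + sqn g.
Proof.
rewrite sqnD sqnN ipNr.
by case: (ip f g) => a b /=; rewrite mulrN.
Qed.

Lemma sqnD_le f g : sqn (f + g) <= 2 * sqn f + 2 * sqn g.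
Proof.
have := sqn_ge0 (f - g); rewrite sqnB sqnD.
by move: (sqn f) (sqn g) (Re (ip f g)) => x y z; lra.
Qed.

(* Expanding the square norm of [sqn g f - <f,g> g]. *)
Lemma ip_CauchySchwarz f g : normc (ip f g) ^+ 2 <= sqn f * sqn g.
Proof.
have [g0|] := eqVneq (sqn g) 0.
  rewrite (sqn_eq0 g0) ip0r sqn0 mulr0 Normc.normc0 expr0n /=; exact: lexx.
move=> gn0; have g0 : 0 < sqn g by rewrite lt_def gn0 sqn_ge0.
have E : ip ((sqn g)%:C%C *: f) (ip f g *: g) = (sqn g * normc (ip f g) ^+ 2)%:C%C.
  by rewrite ipZl ipZr [(_^*)%C * _]mulrC mul_conj [RHS]rmorphM; reflexivity.
have := sqn_ge0 ((sqn g)%:C%C *: f - ip f g *: g).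
rewrite sqnB !sqnZ E normc_real (ger0_norm (sqn_ge0 g)) [Re _]/= => H.
rewrite -(ler_pM2l g0); move: H.
by move: (normc (ip f g)) (sqn f) (sqn g) => x y z; nra.
Qed.

Definition orthon (s : seq CG) :=
  uniq s /\ forall u v, u \in s -> v \in s -> ip u v = (u == v)%:R.

Definition oproj (s : seq CG) f : CG := \sum_(u <- s) ip f u *: u.

Lemma ip_proj s f v : orthon s -> v \in s -> ip (oproj s f) v = ip f v.
Proof.
move=> [us os] vs; rewrite ip_suml (bigD1_seq v)//= ipZl (os v v vs vs) eqxx mulr1.
rewrite big1_seq ?addr0// => u /andP[uv us'].
by rewrite ipZl (os u v us' vs) (negbTE uv) mulr0.
Qed.

Lemma ip_sub_proj s f v : orthon s -> v \in s -> ip (f - oproj s f) v = 0.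
Proof. by move=> os vs; rewrite ipBl ip_proj// subrr. Qed.

Lemma ip_projr s f h : ip h (oproj s f) = \sum_(u <- s) ((ip f u)^*)%C * ip h u.
Proof. by rewrite ip_sumr; apply: eq_bigr => u _; rewrite ipZr. Qed.

Lemma ip_sub_proj_proj s f g : orthon s -> ip (f - oproj s f) (oproj s g) = 0.
Proof.
move=> os; rewrite ip_projr big1_seq// => u /= us.
by rewrite ip_sub_proj// mulr0.
Qed.

Lemma sqn_proj s f : orthon s ->
  sqn (oproj s f) = \sum_(u <- s) normc (ip f u) ^+ 2.
Proof.
move=> os; apply: complexI; rewrite -ip_sqn ip_projr rmorph_sum.
by apply: eq_big_seq => u us; rewrite ip_proj// mulrC mul_conj.
Qed.

Lemma sqn_pythagoras s f : orthon s ->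
  sqn f = sqn (f - oproj s f) + sqn (oproj s f).
Proof.
move=> os; have := sqnD (f - oproj s f) (oproj s f).
by rewrite subrK (ip_sub_proj_proj _ _ os) mulr0 addr0.
Qed.

Lemma Bessel s f : orthon s -> \sum_(u <- s) normc (ip f u) ^+ 2 <= sqn f.
Proof.
by move=> os; rewrite -(sqn_proj f os) (sqn_pythagoras f os) lerDr sqn_ge0.
Qed.

Lemma subspaceP (V : set CG) : linear_subspace V <->
  V 0 /\ forall a u v, V u -> V v -> V (a *: u + v).
Proof.
split=> [[V0 VD]|[V0 VD]]; split.
- by have := V0; rewrite inE.
- by move=> a u v Vu Vv; have := VD a u v; rewrite !inE; apply.
- by rewrite inE.
- by move=> a u v; rewrite !inE; exact: VD.
Qed.

Lemma subspaceD (V : set CG) u v : linear_subspace V -> V u -> V v -> V (u + v).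
Proof. by move=> /subspaceP[_ H] Vu Vv; rewrite -[u]scale1r; exact: H. Qed.

Lemma subspaceZ (V : set CG) a u : linear_subspace V -> V u -> V (a *: u).
Proof. by move=> /subspaceP[V0 H] Vu; rewrite -[_ *: _]addr0; exact: H. Qed.

Lemma subspaceB (V : set CG) u v : linear_subspace V -> V u -> V v -> V (u - v).
Proof.
by move=> VS Vu Vv; apply: subspaceD => //; rewrite -scaleN1r; exact: subspaceZ.
Qed.

Lemma subspace_sum (V : set CG) (I : eqType) (s : seq I) (F : I -> CG) :
  linear_subspace V -> (forall i, i \in s -> V (F i)) -> V (\sum_(i <- s) F i).
Proof.
move=> VS; elim: s => [|i s IH] H; first by rewrite big_nil; case/subspaceP: VS.
rewrite big_cons; apply: subspaceD => //; first by apply: H; rewrite mem_head.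
by apply: IH => j js; apply: H; rewrite inE js orbT.
Qed.

Lemma subspace_proj (V : set CG) s f : linear_subspace V ->
  (forall u, u \in s -> V u) -> V (oproj s f).
Proof. by move=> VS H; apply: subspace_sum => // u us; apply: subspaceZ; auto. Qed.

Lemma orthon_cons s v : orthon s -> sqn v = 1 -> (forall u, u \in s -> ip v u = 0) ->
  orthon (v :: s).
Proof.
move=> [us os] v1 vs; have vv : ip v v = 1 by rewrite ip_sqn v1.
have vns : v \notin s.
  apply/negP => /vs; rewrite vv => /eqP; by rewrite oner_eq0.
split=> [|x y]; first by rewrite /= vns.
rewrite !inE => /orP[/eqP->|xs] /orP[/eqP->|ys].
- by rewrite eqxx vv.
- by rewrite vs//; case: eqP => // E; rewrite E ys in vns.
- rewrite ipC vs// conjc0; case: eqP => // E; by rewrite -E xs in vns.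
- exact: os.
Qed.

Lemma normalize f : f <> 0 -> exists2 a : C, a != 0 & sqn (a *: f) = 1.
Proof.
move=> f0; have n0 : 0 < sqn f.
  by rewrite lt_def sqn_ge0 andbT; apply/eqP => /sqn_eq0.
have s0 : 0 < Num.sqrt (sqn f) by rewrite sqrtr_gt0.
exists ((Num.sqrt (sqn f))^-1)%:C%C.
  by rewrite fmorph_eq0 invr_eq0 gt_eqF.
rewrite sqnZ normc_real ger0_norm ?invr_ge0 ?ltW// exprVn sqr_sqrtr ?ltW//.
by rewrite mulVf// gt_eqF.
Qed.

(** One Gram-Schmidt step: the normalised remainder [f - oproj s f] is put in front. *)
Lemma orthon_extend (V : set CG) s f : linear_subspace V -> orthon s ->
  (forall u, u \in s -> V u) -> V f -> f <> oproj s f ->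
  exists s', [/\ orthon s', (forall u, u \in s' -> V u) & size s' = (size s).+1].
Proof.
move=> VS os sV Vf fn; have [|a a0 a1] := @normalize (f - oproj s f).
  by move=> /eqP; rewrite subr_eq0 => /eqP.
exists (a *: (f - oproj s f) :: s); split=> //.
  by apply: orthon_cons => // u us; rewrite ipZl ip_sub_proj// mulr0.
move=> u; rewrite inE => /orP[/eqP->|]; last exact: sV.
by apply: subspaceZ => //; apply: subspaceB => //; exact: subspace_proj.
Qed.

(** A longest orthonormal list in [V] spans it, since otherwise [orthon_extend] would lengthen it;
    its length stands in for the dimension. *)
Lemma max_orthon (V : set CG) N : linear_subspace V ->
  (forall s, orthon s -> (forall u, u \in s -> V u) -> (size s <= N)%N) ->
  exists s, [/\ orthon s, (forall u, u \in s -> V u),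
    (forall f, V f -> f = oproj s f) &
    forall s', orthon s' -> (forall u, u \in s' -> V u) -> (size s' <= size s)%N].
Proof.
move=> VS HN.
pose P n := `[< exists s, [/\ orthon s, (forall u, u \in s -> V u) & size s = n] >].
have P0 : exists n, P n by exists 0%N; apply/asboolP; exists [::].
have PN n : P n -> (n <= N)%N by move=> /asboolP[s [os sV <-]]; exact: HN.
case: (ex_maxnP P0 PN) => n /asboolP[s [os sV sn]] nmax; exists s; split=> //.
- move=> f Vf; apply: contrapT => fn.
  have [s' [os' sV' ss']] := orthon_extend VS os sV Vf fn.
  have : P (size s') by apply/asboolP; exists s'.
  by move=> /nmax; rewrite ss' sn ltnn.
- by move=> s' os' sV'; rewrite sn; apply: nmax; apply/asboolP; exists s'.
Qed.

Lemma ip_translate a f g : ip (left_translate a f) (left_translate a g) = ip f g.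
Proof. by rewrite !ipE -(mean_lmul a^-1%g (prod_cc f g)). Qed.

Lemma translateD a f g :
  left_translate a (f + g) = left_translate a f + left_translate a g.
Proof. exact: contFunP. Qed.

Lemma translateZ a c f : left_translate a (c *: f) = c *: left_translate a f.
Proof. exact: contFunP. Qed.

Lemma translateM a b f :
  left_translate (a * b)%g f = left_translate a (left_translate b f).
Proof. by apply: contFunP => t /=; rewrite invgM mulgA. Qed.

Lemma translate1 f : left_translate 1%g f = f.
Proof. by apply: contFunP => t /=; rewrite invg1 mul1g. Qed.

End InnerProductSpace.

(** * Convolution operators *)

Section Convolution.
Variables (R : realType) (G : compactGroupType).
Local Notation C := R[i].
Local Notation CG := (contFun R G).
Local Notation normc := (@Normc.normc R).
Local Notation Re := (@complex.Re R).
Local Notation Im := (@complex.Im R).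
Implicit Types f g h : CG.

Variables (phi : G -> C) (K : R).
Variable phi_cc : ccontinuous phi.

Lemma ccontinuous_pair_fst (T U : topologicalType) (p : U -> C) :
  ccontinuous p -> ccontinuous (fun z : T * U => p z.2).
Proof. by move=> pc; apply: ccontinuous_comp pc => z; exact: cvg_snd. Qed.

Lemma kernel_cc : ccontinuous (fun z : G * G => phi (z.1 * z.2^-1)%g).
Proof.
apply: (ccontinuous_comp (f := fun z : G * G => (z.1 * z.2^-1)%g) _ phi_cc).
apply: continuous_mulg2; first by move=> z; exact: cvg_fst.
by apply: continuous_invg => z; exact: cvg_snd.
Qed.

Lemma convol_integrand_cc f :
  ccontinuous (fun z : G * G => phi (z.1 * z.2^-1)%g * f z.2).
Proof.
exact: (ccontinuousM kernel_cc (ccontinuous_pair_fst (contFun_ccontinuous f))).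
Qed.

Definition convol f : CG := ccFun (mean_continuous (convol_integrand_cc f)).

Lemma convolE f t : convol f t = mean (fun u => phi (t * u^-1)%g * f u) :> C.
Proof. by []. Qed.

Lemma convol_linear a f g : convol (a *: f + g) = a *: convol f + convol g.
Proof.
apply: contFunP => t; rewrite contFunD contFunZ !convolE.
have fc := ccontinuous_pairr t (convol_integrand_cc f).
have gc := ccontinuous_pairr t (convol_integrand_cc g).
rewrite -(meanZ _ fc) -(meanD (ccontinuousM (ccontinuous_cst a) fc) gc).
by apply: eq_mean => u /=; rewrite mulrDr mulrCA.
Qed.

Lemma convolD f g : convol (f + g) = convol f + convol g.
Proof. by rewrite -[f]scale1r convol_linear !scale1r. Qed.

Lemma convol0 : convol 0 = 0.
Proof.
have E := convolD 0 0; rewrite addr0 in E.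
by apply: (@addrI _ (convol 0)); rewrite addr0 -E.
Qed.

Lemma convolZ a f : convol (a *: f) = a *: convol f.
Proof. by rewrite -[a *: f]addr0 convol_linear convol0 addr0. Qed.

Lemma convolB f g : convol (f - g) = convol f - convol g.
Proof. by rewrite convolD -scaleN1r convolZ scaleN1r. Qed.

(** The substitution [u = s^-1 t] exhibits convolution as a mean of left translates of [f] with
    weight [phi]. This form serves both for stability of [X] and for approximation of [f]. *)
Lemma convol_shift f t : convol f t = mean (fun s => phi s * f (s^-1 * t)%g) :> C.
Proof.
have fc := ccontinuous_pairr t (convol_integrand_cc f).
rewrite convolE -(mean_inv fc) -(mean_lmul t^-1%g (ccontinuous_inv fc)).
by apply: eq_mean => s /=; rewrite invgK mulVKg invgM invgK.
Qed.

Definition kern t : CG :=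
  ccFun (ccontinuous_conj (ccontinuous_pairr t kernel_cc)).

Lemma convol_ip f t : convol f t = ip f (kern t) :> C.
Proof.
rewrite convolE ipE; apply: eq_mean => u.
by rewrite mulrC; congr (_ * _); rewrite /= conjcK.
Qed.

(** Cauchy-Schwarz against [kern t - kern t'], which is uniformly small; the neighbourhood does not
    depend on [f]. *)
Lemma convol_equicontinuous t (e : R) : 0 < e -> \forall t' \near t,
  forall f, sqn f <= 1 -> normc (convol f t - convol f t') <= e.
Proof.
move=> e0; have := uniform_near (@group_compact G) kernel_cc t e0.
apply: filterS => t' H f f1; rewrite !convol_ip -ipBr.
rewrite -(@ler_pXn2r _ 2) ?nnegrE ?normc_ge0 ?(ltW e0)//.
apply: le_trans (ip_CauchySchwarz _ _) _.
have He : sqn (kern t - kern t') <= e ^+ 2.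
  apply: sqn_le => x; rewrite contFunB /= -rmorphB normc_conj; exact: ltW (H x).
apply: le_trans (_ : 1 * e ^+ 2 <= _); last by rewrite mul1r; exact: lexx.
by apply: ler_pM; rewrite ?sqn_ge0.
Qed.

(** By [convol_shift] and [uniform_left_mean], [convol f] is a uniform limit of finite combinations
    of left translates of [f]. *)
Lemma convol_closed (X : set CG) f : closed X -> linear_subspace X ->
  (forall s f, X f -> X (left_translate s f)) -> X f -> X (convol f).
Proof.
move=> Xc Xl Xi Xf; apply: closed_approx => // e e0.
have Fc : ccontinuous (fun z : G * G => phi z.2 * f (z.2^-1 * z.1)%g).
  apply: ccontinuousM; first exact: ccontinuous_pair_fst.
  apply: (ccontinuous_comp (f := fun z : G * G => (z.2^-1 * z.1)%g)
    (g := (f : G -> C)) _ (contFun_ccontinuous f)).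
  apply: continuous_mulg2; last by move=> z; exact: cvg_fst.
  by apply: continuous_invg => z; exact: cvg_snd.
have [s s0 Hs] := uniform_left_mean Fc e0.
exists (((size s)%:R)^-1 *: \sum_(a <- s) phi a *: left_translate a f).
  apply: subspaceZ => //; apply: subspace_sum => // a _.
  by apply: subspaceZ => //; exact: Xi.
move=> t; rewrite convol_shift normc_distC; have := Hs t 1%g; congr (normc (_ - _) <= _).
rewrite contFunZ contFun_sum mulrC /avg; congr (_ / _).
by apply: eq_bigr => a _; rewrite /= mulg1.
Qed.

Variable phi_le : forall x, normc (phi x) <= K.

Lemma sqn_kern t : sqn (kern t) <= K ^+ 2.
Proof. by apply: sqn_le => x; rewrite /= normc_conj. Qed.

(** The passage from mean-square to uniform bounds: each value of [convol f] is an inner product of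
    [f] with a section of the kernel. *)
Lemma convol_le f t : normc (convol f t) ^+ 2 <= K ^+ 2 * sqn f.
Proof.
rewrite convol_ip; apply: le_trans (ip_CauchySchwarz _ _) _.
rewrite mulrC; apply: ler_wpM2r; [exact: sqn_ge0|exact: sqn_kern].
Qed.

Lemma sqnE f : sqn f = Re (mean (fun x => (normc (f x) ^+ 2)%:C%C)).
Proof.
have E : (fun x => f x * ((f x)^*)%C) =1 (fun x => (normc (f x) ^+ 2)%:C%C).
  by move=> x; exact: mul_conj.
by rewrite /sqn ipE (eq_mean E).
Qed.

Lemma sqn_convol_le f : sqn (convol f) <= K ^+ 2 * sqn f.
Proof.
have K0 : 0 <= K ^+ 2 * sqn f by rewrite mulr_ge0 ?sqr_ge0 ?sqn_ge0.
rewrite -(sqr_sqrtr K0); apply: sqn_le => t.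
rewrite -(@ler_pXn2r _ 2) ?nnegrE ?normc_ge0 ?sqrtr_ge0// sqr_sqrtr//.
exact: convol_le.
Qed.

Lemma normc_sqr_cc f : ccontinuous (fun x => (normc (f x) ^+ 2)%:C%C).
Proof.
have fc := contFun_ccontinuous f; move=> x e e0.
have := ccontinuousM fc (ccontinuous_conj fc) x e0.
by apply: filterS => y; rewrite !mul_conj.
Qed.

(* Bessel's inequality for the kernel sections, averaged over the group. *)
Lemma convol_Bessel (s : seq CG) : orthon s ->
  \sum_(u <- s) sqn (convol u) <= K ^+ 2.
Proof.
move=> os.
have E : \sum_(u <- s) sqn (convol u) =
    Re (mean (fun t => \sum_(u <- s) (normc (convol u t) ^+ 2)%:C%C)).
  rewrite (mean_sum s (fun u => normc_sqr_cc (convol u))).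
  rewrite (raddf_sum (@complex.Re R : Rcomplex R -> R)).
  by apply: eq_bigr => u _; rewrite sqnE.
rewrite E; apply: mean_Re_le => [|t].
  by apply: ccontinuous_sum => u; exact: normc_sqr_cc.
rewrite -rmorph_sum -[leLHS]/(\sum_(u <- s) normc (convol u t) ^+ 2).
apply: le_trans (sqn_kern t).
apply: le_trans (Bessel (kern t) os); apply: ler_sum => u _.
by rewrite convol_ip ipC normc_conj.
Qed.

Variable phi_real : forall x, ((phi x)^*)%C = phi x.
Variable phi_inv : forall x, phi x^-1%g = phi x.
Variable phi_class : forall x y, phi (x * y)%g = phi (y * x)%g.

Lemma convol_sym f g : ip (convol f) g = ip f (convol g).
Proof.
have Fc : ccontinuous (fun z : G * G =>
    phi (z.1 * z.2^-1)%g * f z.2 * ((g z.1)^*)%C).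
  apply: (ccontinuousM (convol_integrand_cc f)).
  apply: ccontinuous_conj.
  apply: (ccontinuous_comp (f := fst) (g := (g : G -> C)) _ (contFun_ccontinuous g)).
  by move=> z; exact: cvg_fst.
transitivity (mean (fun t => mean (fun u =>
    phi (t * u^-1)%g * f u * ((g t)^*)%C))).
  rewrite ipE; apply: eq_mean => t; rewrite convolE mulrC.
  rewrite -(meanZ _ (ccontinuous_pairr t (convol_integrand_cc f))).
  by apply: eq_mean => u; rewrite mulrC.
rewrite (mean_exchange Fc) ipE; apply: eq_mean => u; rewrite [LHS]/= convolE.
have gc := ccontinuous_pairr u (convol_integrand_cc g).
rewrite -(mean_conj gc) -(meanZ _ (ccontinuous_conj gc)).
apply: eq_mean => t /=; rewrite rmorphM /= phi_real -phi_inv invgM invgK.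
by rewrite mulrAC mulrA mulrC mulrA.
Qed.

(** After [u] is replaced by [s u], the kernel is [phi (t u^-1 s^-1)]; only a class function lets
    [s^-1] move to the front. *)
Lemma convol_translate s f : convol (left_translate s f) = left_translate s (convol f).
Proof.
apply: contFunP => t; rewrite convolE.
have fc := ccontinuous_pairr t (convol_integrand_cc (left_translate s f)).
rewrite -(mean_lmul s fc).
apply: (@etrans _ _ (convol f (s^-1 * t)%g)); last by [].
rewrite convolE; apply: eq_mean => u /=.
by rewrite mulKg invgM mulgA (phi_class _ s^-1%g) mulgA.
Qed.

End Convolution.

(** * Central bump functions and approximation of [f] by convolution *)

Section CentralBump.
Variables (R : realType) (G : compactGroupType).
Local Notation C := R[i].
Local Notation CG := (contFun R G).
Local Notation normc := (@Normc.normc R).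
Local Notation Re := (@complex.Re R).
Local Notation Im := (@complex.Im R).
Implicit Types f g h : CG.

Definition displacement f (s : G) : R :=
  sup (range (fun z : G * G => normc (f (z.1 * s * z.2)%g - f (z.1 * z.2)%g))).

Lemma displacement_ub f s u v :
  normc (f (u * s * v)%g - f (u * v)%g) <= displacement f s.
Proof.
apply: ub_le_sup; last by exists (u, v).
exists (supnorm f + supnorm f) => _ [z _ <-].
by rewrite (le_trans (le_normcD _ _))// normcN lerD// supnorm_ub.
Qed.

Lemma displacement_le f s M :
  (forall u v, normc (f (u * s * v)%g - f (u * v)%g) <= M) -> displacement f s <= M.
Proof.
move=> H; apply: ge_sup => [|_ [z _ <-]]; last exact: H.
by exists (normc (f (1 * s * 1)%g - f (1 * 1)%g)), (1%g, 1%g).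
Qed.

Lemma displacement_ge0 f s : 0 <= displacement f s.
Proof. exact: le_trans (normc_ge0 _) (displacement_ub f s 1 1)%g. Qed.

Lemma displacement1 f : displacement f 1%g = 0.
Proof.
apply/eqP; rewrite eq_le displacement_ge0 andbT; apply: displacement_le => u v.
by rewrite mulg1 subrr Normc.normc0 lexx.
Qed.

Lemma displacement_inv f s : displacement f s^-1%g = displacement f s.
Proof.
suff H t : displacement f t^-1%g <= displacement f t.
  by apply/eqP; rewrite eq_le H -{1}[s]invgK H.
apply: displacement_le => u v; rewrite normc_distC.
have := displacement_ub f t (u * t^-1)%g v.
by rewrite mulgVK.
Qed.

(** Since the supremum runs over factors on both sides, [u (z w) v = (u z) (w z) (z^-1 v)] suffices:
    deleting the middle factor leaves [u v] in either reading. *)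
Lemma displacement_class f x y : displacement f (x * y)%g = displacement f (y * x)%g.
Proof.
suff H z w : displacement f (z * w)%g <= displacement f (w * z)%g.
  by apply/eqP; rewrite eq_le !H.
apply: displacement_le => u v.
have := displacement_ub f (w * z)%g (u * z)%g (z^-1 * v)%g.
by rewrite !mulgA !mulgK.
Qed.

Lemma displacement_continuous f : continuous (displacement f).
Proof.
move=> s; apply/(@cvgrPdist_lt R R^o _ _ (nbhs_filter s)) => e e0.
have e20 : 0 < e / 2 by rewrite divr_gt0.
have cGG : compact [set: G * G].
  by rewrite -setXTT; apply: compact_setX; exact: group_compact.
have Fc : ccontinuous (fun z : G * (G * G) => f (z.2.1 * z.1 * z.2.2)%g : C).
  apply: (ccontinuous_comp (f := fun z : G * (G * G) => (z.2.1 * z.1 * z.2.2)%g)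
    (g := (f : G -> C)) _ (contFun_ccontinuous f)).
  apply: continuous_mulg2; first apply: continuous_mulg2.
  - apply: continuous_compT; last by move=> z; exact: cvg_fst.
    by move=> z; exact: cvg_snd.
  - by move=> z; exact: cvg_fst.
  - apply: continuous_compT; last by move=> z; exact: cvg_snd.
    by move=> z; exact: cvg_snd.
have := uniform_near cGG Fc s e20; apply: filterS => s' H.
have {}H u v : normc (f (u * s * v)%g - f (u * s' * v)%g) <= e / 2.
  exact: ltW (H (u, v)).
suff K a b : (forall u v, normc (f (u * a * v)%g - f (u * b * v)%g) <= e / 2) ->
    displacement f a <= e / 2 + displacement f b.
  have K1 := K _ _ H; have K2 : displacement f s' <= e / 2 + displacement f s.
    by apply: K => u v; rewrite normc_distC.
  apply: (@le_lt_trans _ _ (e / 2)); last by lra.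
  by rewrite ler_norml; lra.
move=> {}H; apply: displacement_le => u v.
rewrite -(subrKA (f (u * b * v)%g)) (le_trans (le_normcD _ _))// lerD//.
exact: displacement_ub.
Qed.

(* [phi] is supported where translation moves [f] by less than [e] in
   supremum norm. *)
Lemma central_bump f (e : R) : 0 < e -> exists phi : G -> R,
  [/\ continuous phi, forall x, 0 <= phi x <= e, phi 1%g = e,
      (forall x, phi x^-1%g = phi x) /\ (forall x y, phi (x * y)%g = phi (y * x)%g) &
      forall s t, phi s * normc (f (s^-1 * t)%g - f t) <= phi s * e].
Proof.
move=> e0; exists (fun s => Num.max 0 (e - displacement f s)); split.
- move=> x; apply: (@continuous_max _ _ (fun=> 0) (fun s => e - displacement f s)).
    exact: cst_continuous.
  apply: (@cvgB R R^o); first exact: cvg_cst.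
  exact: displacement_continuous.
- move=> x; rewrite le_max lexx /= ge_max ltW//=.
  by have := displacement_ge0 f x; lra.
- by rewrite displacement1 subr0; apply/max_idPr; exact: ltW.
- by split=> [x|x y]; rewrite ?displacement_inv// displacement_class.
(* If [displacement f s <= e], it controls the difference through the pair [1, t] at [s^-1], which
   has the same displacement; otherwise [phi s = 0]. *)
- move=> s t; case: (leP 0 (e - displacement f s)) => [H|_]; last by rewrite !mul0r.
  apply: ler_wpM2l => //; rewrite -displacement_inv in H.
  have := displacement_ub f s^-1%g 1%g t; rewrite !mul1g.
  by move: (normc _) (displacement _ _) H => a b; lra.
Qed.

Lemma mean_Re_mono (p q : G -> C) : ccontinuous p -> ccontinuous q ->
  (forall x, Re (p x) <= Re (q x)) -> Re (mean p) <= Re (mean q).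
Proof.
move=> pc qc H; have : 0 <= Re (mean (fun x => q x - p x)).
  apply: mean_Re_ge => [|x]; first exact: ccontinuousB.
  by have := H x; case: (p x) (q x) => [a b] [c d] /=; lra.
rewrite (meanB qc pc).
by case: (mean p) (mean q) => [a b] [c d] /=; lra.
Qed.

(* Integrate [Re (conj m * p x)] with [m = mean p]. *)
Lemma mean_normc_le (p : G -> C) (q : G -> R) : ccontinuous p ->
  continuous q -> (forall x, normc (p x) <= q x) ->
  normc (mean p) <= Re (mean (fun x => (q x)%:C%C)).
Proof.
move=> pc qc H; set m := mean p.
have [->|m0] := eqVneq m 0.
  rewrite Normc.normc0; apply: mean_Re_ge; first exact: ccontinuous_real.
  by move=> x; exact: le_trans (normc_ge0 _) (H x).
have n0 : 0 < normc m.
  rewrite lt_def normc_ge0 andbT; apply/eqP => /Normc.eq0_normc E.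
  by rewrite E eqxx in m0.
have Qc := ccontinuous_real qc.
have c1 : ccontinuous (fun x => (m^*)%C * p x).
  exact: ccontinuousM (ccontinuous_cst _) pc.
have c2 : ccontinuous (fun x => (normc m)%:C%C * (q x)%:C%C).
  exact: ccontinuousM (ccontinuous_cst _) Qc.
have := mean_Re_mono c1 c2; rewrite (meanZ _ pc) (meanZ _ Qc) -/m.
rewrite [(m^*)%C * m]mulrC mul_conj.
have -> (a : R) (z : C) : Re (a%:C%C * z) = a * Re z.
  by case: z => x y /=; rewrite mul0r subr0.
rewrite [Re _%:C%C]/= expr2 (ler_pM2l n0); apply=> x.
apply: le_trans (ler_norm _) (le_trans (normc_Re _) _).
rewrite Normc.normcM normc_conj -rmorphM [Re _]/=.
by apply: ler_wpM2l; [exact: normc_ge0|exact: H].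
Qed.

(** By [convol_shift] the difference is the mean of [phi s] times [f (s^-1 t) - f t], whose modulus
    is at most [phi s * e]. *)
Lemma convol_approx f (phi : G -> R) (phic : ccontinuous (fun x => (phi x)%:C%C))
    (e : R) : continuous phi -> (forall x, 0 <= phi x) ->
  (forall s t, phi s * normc (f (s^-1 * t)%g - f t) <= phi s * e) ->
  let c := mean (fun x => (phi x)%:C%C) in
  forall t, normc (convol phic f t - c * f t) <= Re c * e.
Proof.
move=> pc p0 H c t; rewrite convol_shift.
have fc : ccontinuous (fun s => f (s^-1 * t)%g : C).
  apply: (ccontinuous_comp (f := fun s : G => (s^-1 * t)%g) (g := (f : G -> C)) _
    (contFun_ccontinuous f)).
  apply: continuous_mulg2; last exact: cst_continuous.
  by apply: continuous_invg => z; exact: cvg_id.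
have c1 := ccontinuousM phic fc.
have E : c * f t = mean (fun s => (phi s)%:C%C * f t).
  rewrite mulrC -(meanZ _ phic); apply: eq_mean => s; exact: mulrC.
have c2 : ccontinuous (fun s => (phi s)%:C%C * (f t : C)).
  exact: ccontinuousM phic (ccontinuous_cst _).
rewrite E -(meanB c1 c2).
have qc : continuous (fun s => phi s * e).
  by move=> s; apply: (@cvgM R); [exact: pc|exact: cvg_cst].
apply: (le_trans (mean_normc_le (ccontinuousB c1 c2) qc _)) => [s|].
  by rewrite -mulrBr Normc.normcM normc_real ger0_norm.
suff -> : mean (fun s => (phi s * e)%:C%C) = e%:C%C * c.
  by case: c {E} => a b /=; rewrite mul0r subr0 mulrC.
rewrite -(meanZ _ phic); apply: eq_mean => s.
by rewrite mulrC; exact: rmorphM.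
Qed.

End CentralBump.

(** * Eigenvectors of convolution operators *)

Section Eigenvector.
Variables (R : realType) (G : compactGroupType).
Local Notation C := R[i].
Local Notation CG := (contFun R G).
Local Notation normc := (@Normc.normc R).
Local Notation Re := (@complex.Re R).
Local Notation Im := (@complex.Im R).
Implicit Types f g h : CG.

(** Compactness of the segment gives a cluster point. An ultrafilter contains each set or its
    complement, and the complement of a neighbourhood would contradict clustering. *)
Lemma ultra_limit (T : Type) (U : set_system T) (h : T -> R) (K : R) :
  UltraFilter U -> U [set x | `|h x| <= K] ->
  exists c, forall e, 0 < e -> U [set x | `|h x - c| <= e].
Proof.
move=> UU UK; have PU : ProperFilter U by exact: ultra_proper.
have [c [_ Hc]] : `[- K, K]%classic `&` cluster (h @ U) !=set0.
  apply: segment_compact; apply: filterS UK => x Hx.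
  by rewrite /= in_itv /= -ler_norml; exact: Hx.
exists c => e e0.
have [//|UN] := in_ultra_setVsetC [set x | `|h x - c| <= e] UU.
have UN' : (h @ U) [set y | ~ (`|y - c| <= e)] by exact: UN.
have [y [Hx Hy]] := Hc _ _ UN' (nbhsx_ballx c e e0).
exfalso; apply: Hx => /=.
by move: Hy; rewrite -ball_normE /= distrC => /ltW.
Qed.

Lemma ultra_limitC (T : Type) (U : set_system T) (h : T -> C) (K : R) :
  UltraFilter U -> U [set x | normc (h x) <= K] ->
  exists c, forall e, 0 < e -> U [set x | normc (h x - c) <= e].
Proof.
move=> UU UK; have PU : ProperFilter U by exact: ultra_proper.
have [a Ha] := @ultra_limit _ U (fun x => Re (h x)) K UU
  (filterS (fun x => le_trans (normc_Re (h x))) UK).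
have [b Hb] := @ultra_limit _ U (fun x => Im (h x)) K UU
  (filterS (fun x => le_trans (normc_Im (h x))) UK).
exists (a +i* b)%C => e e0; have e20 : 0 < e / 2 by rewrite divr_gt0.
apply: filterS2 (Ha _ e20) (Hb _ e20) => x /= H1 H2.
apply: le_trans (normc_ReIm _) _; rewrite [leRHS]splitr; apply: lerD.
- by move: H1; case: (h x).
- by move: H2; case: (h x).
Qed.

Variables (phi : G -> C) (K : R).
Variable phi_cc : ccontinuous phi.
Variable phi_le : forall x, normc (phi x) <= K.
Local Notation T := (convol phi_cc).

(* The image under [T] of the unit ball of the inner product is equicontinuous
   and bounded, so an ultrafilter on the ball converges uniformly along [T]. *)
Lemma convol_compact (A : R -> set CG) :
  (forall e, 0 < e -> A e !=set0) ->
  (forall e f, A e f -> sqn f = 1) ->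
  (forall e e', e <= e' -> A e `<=` A e') ->
  exists g, forall e, 0 < e ->
    exists2 f, A e f & forall t, normc (T f t - g t) <= e.
Proof.
move=> An A1 Ai.
have FF : Filter (filter_from [set e : R | 0 < e] A).
  apply: filter_from_filter; first by exists 1 => /=.
  move=> e e' /= e0 e0'; exists (Num.min e e'); first by rewrite /= lt_min e0.
  by move=> f Af; split; apply: Ai Af; rewrite ge_min lexx ?orbT.
have FP := filter_from_proper FF An.
have [U [UU FU]] := ultraFilterLemma FP.
have PU : ProperFilter U by exact: ultra_proper.
have UA e : 0 < e -> U (A e) by move=> e0; apply: FU; exists e.
have U1 : U [set f | sqn f <= 1].
  by apply: filterS (UA 1 ltr01) => f /A1 /= ->; exact: lexx.
have K0 : 0 <= K by exact: le_trans (normc_ge0 _) (phi_le 1%g).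
have Hg t : exists c, forall e, 0 < e -> U [set f | normc (T f t - c) <= e].
  apply: (@ultra_limitC _ U (fun f => T f t) K UU); apply: filterS U1 => f /= f1.
  rewrite -(@ler_pXn2r _ 2) ?nnegrE ?normc_ge0//.
  apply: le_trans (convol_le phi_cc phi_le f t) _.
  by rewrite -[leRHS]mulr1; apply: ler_wpM2l => //; exact: sqr_ge0.
pose g t := xget 0 [set c | forall e, 0 < e -> U [set f | normc (T f t - c) <= e]].
have {}Hg t e : 0 < e -> U [set f | normc (T f t - g t) <= e].
  move=> e0; rewrite /g.
  exact: (@xgetPex _ 0 [set c | forall e, 0 < e -> U [set f | normc (T f t - c) <= e]]
    (Hg t) e e0).
(* A common [f] from the ultrafilter is close to [g] at both points; passing through it costs three
   times [e]. *)
have equi t e : 0 < e -> \forall t' \near t,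
    (forall f, sqn f <= 1 -> normc (T f t - T f t') <= e) /\
    normc (g t - g t') <= e + e + e.
  move=> e0; have := convol_equicontinuous phi_cc t e0; apply: filterS => t' H.
  split=> //.
  have [f [/= f1 [f2 f3]]] := filter_ex (filterI U1 (filterI (Hg t _ e0) (Hg t' _ e0))).
  apply: le_trans (normc_triangle (T f t') _ _) _; apply: lerD; last exact: f3.
  apply: le_trans (normc_triangle (T f t) _ _) _; apply: lerD; last exact: H.
  by rewrite normc_distC; exact: f2.
have gc : ccontinuous g.
  move=> t e e0; have e40 : 0 < e / 4 by rewrite divr_gt0.
  have := equi t _ e40; apply: filterS => t' [_ H].
  by apply: le_lt_trans H _; lra.
(* Fifths of [e]: one from [T f t] to [T f a], one from there to [g a], and three from [g a] to
   [g t] by [equi]. *)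
exists (ccFun gc) => e e0; have e50 : 0 < e / 5 by rewrite divr_gt0.
have [l Hl] := finite_net (@group_compact G) (fun t => equi t _ e50).
have Ul : U [set f | forall t, t \in l -> normc (T f t - g t) <= e / 5].
  elim: l {Hl} => [|a l IH]; first by apply: filterS filterT => f _ t.
  apply: filterS2 (Hg a _ e50) IH => f /= H1 H2 t.
  by rewrite inE => /orP[/eqP ->//|]; exact: H2.
have [f [/= Uf [/= f1 Af]]] := filter_ex (filterI Ul (filterI U1 (UA e e0))).
exists f => // t; have [a al [Ha1 Ha2]] := Hl t.
have -> : e = e / 5 + (e / 5 + (e / 5 + e / 5 + e / 5)) by field.
apply: le_trans (normc_triangle (T f a) _ _) _; apply: lerD.
  by rewrite normc_distC; exact: Ha1.
apply: le_trans (normc_triangle (g a) _ _) _; apply: lerD; first exact: Uf.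
exact: Ha2.
Qed.

Variable phi_real : forall x, ((phi x)^*)%C = phi x.
Variable phi_inv : forall x, phi x^-1%g = phi x.

(** The restriction [e <= 1] lets callers absorb [e ^+ 2] into [e]. *)
Lemma le0_small (x B : R) : 0 <= B ->
  (forall e, 0 < e -> e <= 1 -> x <= B * e) -> x <= 0.
Proof.
move=> B0 H; apply/ler_addgt0Pr => e e0; rewrite add0r.
have B1 : 0 < B + 1 by lra.
pose d := Num.min 1 (e / (B + 1)).
have d0 : 0 < d by rewrite lt_min ltr01 divr_gt0.
have d1 : d <= 1 by rewrite ge_min lexx.
apply: le_trans (H d d0 d1) _.
apply: (@le_trans _ _ ((B + 1) * d)); first by rewrite ler_pM2r//; lra.
by rewrite mulrC -ler_pdivlMr// ge_min lexx orbT.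
Qed.

(** From [(T - l) (T + l) g = 0]: either [g] is an eigenvector for [- l], or [T g + l g] is one for
    [l]. *)
Lemma eigen_sqrt (Y : set CG) (l : R) g : linear_subspace Y ->
  (forall f, Y f -> Y (T f)) -> Y g -> g <> 0 ->
  T (T g) = (l ^+ 2)%:C%C *: g ->
  exists nu h, [/\ Y h, h <> 0, T h = (nu%:C)%C *: h & nu ^+ 2 = l ^+ 2].
Proof.
move=> Yl YT Yg g0 HT.
have [E|N] := pselect (T g + (l%:C)%C *: g = 0).
  exists (- l), g; split=> //; last by rewrite sqrrN.
  by apply/eqP; rewrite rmorphN scaleNr -addr_eq0 E.
exists l, (T g + (l%:C)%C *: g); split=> //.
  by apply: subspaceD => //; [exact: YT|exact: subspaceZ].
by rewrite convolD convolZ HT scalerDr addrC scalerA -rmorphM.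
Qed.

(** Rayleigh quotient: [L] is the supremum of [sqn (T f)] over unit vectors of [Y], and
    near-maximisers [f] almost satisfy [T (T f) = L f]. Compactness gives a limit [g] of the images
    [T f], not of the [f] themselves; [g] is an eigenvector of the square of [T]. *)
Lemma eigenvector (Y : set CG) (e : R) r : closed Y -> linear_subspace Y ->
  (forall f, Y f -> Y (T f)) -> 0 < e -> Y r -> e * sqn r < sqn (T r) ->
  exists nu h, [/\ Y h, h <> 0, T h = (nu%:C)%C *: h & e <= nu ^+ 2].
Proof.
move=> Yc Yl YT e0 Yr Hr.
have K2 f : sqn (T f) <= K ^+ 2 * sqn f by exact: sqn_convol_le.
have K20 : 0 <= K ^+ 2 by exact: sqr_ge0.
pose S : set R := [set x | exists f, [/\ Y f, sqn f = 1 & x = sqn (T f)]].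
have r0 : r <> 0.
  by move=> E; move: Hr; rewrite E convol0 sqn0 mulr0 ltxx.
have [a a0 ra] := normalize r0.
have Ya : Y (a *: r) by exact: subspaceZ.
have SN : S (sqn (T (a *: r))) by exists (a *: r).
have Sub : has_ubound S.
  by exists (K ^+ 2) => _ [f [_ f1 ->]]; rewrite -[leRHS]mulr1 -f1.
pose L := sup S.
have eL : e < L.
  apply: (@lt_le_trans _ _ (sqn (T (a *: r)))); last exact: ub_le_sup.
  rewrite convolZ sqnZ; have na0 : 0 < normc a ^+ 2.
    rewrite exprn_gt0// lt_def normc_ge0 andbT; apply/eqP => /Normc.eq0_normc E.
    by rewrite E eqxx in a0.
  rewrite -[e]mulr1 -ra sqnZ mulrCA ltr_pM2l//.
have L0 : 0 < L by exact: lt_trans e0 eL.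
have SL f : Y f -> sqn (T f) <= L * sqn f.
  move=> Yf; have [->|f0] := pselect (f = 0).
    by rewrite convol0 sqn0 mulr0 lexx.
  have [b b0 fb] := normalize f0.
  have : sqn (T (b *: f)) <= L.
    apply: ub_le_sup; first exact: Sub.
    by exists (b *: f); split; [exact: subspaceZ|exact: fb|reflexivity].
  rewrite convolZ sqnZ -[leRHS]mulr1 -fb sqnZ mulrCA ler_pM2l//.
  rewrite exprn_gt0// lt_def normc_ge0 andbT; apply/eqP => /Normc.eq0_normc E.
  by rewrite E eqxx in b0.
pose A (d : R) : set CG := [set f | [/\ Y f, sqn f = 1 & L - d < sqn (T f)]].
have AN d : 0 < d -> A d !=set0.
  move=> d0.
  have [_ [f [Yf f1 ->]] Hf] := @sup_adherent _ S d d0 (conj (ex_intro _ _ SN) Sub).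
  by exists f.
clearbody L; clear SN Sub S.
have [//|d f []//|d d' dd f [Yf f1 Hf]|g Hg] := @convol_compact A.
- split; [exact: Yf|exact: f1|apply: le_lt_trans Hf].
  by rewrite lerD2l lerN2.
have Yg : Y g.
  apply: closed_approx; first exact: Yc.
  move=> d d0; have [f [Yf _ _] H] := Hg d d0.
  by exists (T f) => [|t]; [exact: YT|rewrite normc_distC].
have {}Hg d : 0 < d -> d <= 1 -> exists f, [/\ Y f, sqn f = 1, L - d < sqn (T f) &
    sqn (T f - g) <= d].
  move=> d0 d1; have [f [Yf f1 Hf] H] := Hg d d0; exists f.
  split; [exact: Yf|exact: f1|exact: Hf|].
  apply: le_trans (sqn_le (M := d) _) _; first exact: H.
  by rewrite expr2 -[leRHS]mulr1 ler_pM2l.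
have g0 : g <> 0.
  move=> E; have : L <= 0.
    apply: (@le0_small L 2) => // d d0 d1.
    have [f [_ _ Hf]] := Hg d d0 d1; rewrite E subr0 => Hd.
    by clear -Hf Hd; move: (sqn (T f)) Hf Hd => x; lra.
  by rewrite leNgt L0.
have HT : T (T g) = (L%:C)%C *: g.
  apply/eqP; rewrite -subr_eq0; apply/eqP/sqn_eq0/eqP.
  rewrite eq_le sqn_ge0 andbT.
  (* The weights 4, 4, 2 come from applying [sqnD_le] twice to [(u1 + u2) + u3]. *)
  apply: (@le0_small _ (4 * (K ^+ 2 * K ^+ 2) + 4 * (K ^+ 2 * L) + 2 * L ^+ 2)).
    apply: addr_ge0; first apply: addr_ge0.
    - exact: mulr_ge0 (ler0n _ 4) (mulr_ge0 K20 K20).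
    - exact: mulr_ge0 (ler0n _ 4) (mulr_ge0 K20 (ltW L0)).
    - exact: mulr_ge0 (ler0n _ 2) (sqr_ge0 L).
  move=> d d0 d1; have [f [Yf f1 Hf Hd]] := Hg d d0 d1.
  (* [u1] is the cost of replacing [g] by [T f], [u2] the defect of the eigenvalue equation for [f],
     [u3] the cost of returning to [g]. *)
  pose u1 := T (T (g - T f)); pose u2 := T (T (T f) - (L%:C)%C *: f).
  pose u3 := (L%:C)%C *: (T f - g).
  have -> : T (T g) - (L%:C)%C *: g = (u1 + u2) + u3.
    rewrite /u1 /u2 /u3 !convolB convolZ scalerBr.
    by rewrite !subrKA.
  have Ha : sqn u1 <= K ^+ 2 * K ^+ 2 * d.
    apply: le_trans (K2 _) _; rewrite -mulrA; apply: ler_wpM2l; first exact: K20.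
    apply: le_trans (K2 _) _; apply: ler_wpM2l; first exact: K20.
    by rewrite -sqnN opprB.
  (* With [x = sqn (T f)], self-adjointness and maximality of [L] bound [sqn (T (T f) - L f)] by
     [L x - 2 L x + L ^+ 2 = L (L - x)], hence by [L d]. *)
  have Hb : sqn u2 <= K ^+ 2 * L * d.
    apply: le_trans (K2 _) _; rewrite -mulrA ler_wpM2l//.
    rewrite sqnB sqnZ normc_real (ger0_norm (ltW L0)) f1.
    have -> : Re (ip (T (T f)) ((L%:C)%C *: f)) = L * sqn (T f).
      rewrite ipZr (convol_sym phi_cc phi_real phi_inv) ip_sqn conjc_real.
      by rewrite /= mul0r subr0.
    have := SL _ (YT _ Yf); move: Hf; clear -L0 d0.
    by move: (sqn (T f)) (sqn (T (T f))) => x y; nra.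
  have Hc : sqn u3 <= L ^+ 2 * d.
    by rewrite sqnZ normc_real (ger0_norm (ltW L0)) ler_wpM2l// sqr_ge0.
  apply: le_trans (sqnD_le _ _) _; have := sqnD_le u1 u2; move: Ha Hb Hc; clear.
  by move: (sqn u1) (sqn u2) (sqn u3) (sqn (u1 + u2)) => x y z w; lra.
have lE : L = Num.sqrt L ^+ 2 by rewrite sqr_sqrtr// ltW.
rewrite lE in HT; have [nu [h [Yh h0 Th nuL]]] := eigen_sqrt Yl YT Yg g0 HT.
exists nu, h; split; [exact: Yh|exact: h0|exact: Th|].
by rewrite nuL -lE ltW.
Qed.

End Eigenvector.

(** * Irreducible subspaces as coefficient spaces *)

Section EuclideanSpace.
Variables (R : realType) (n : nat).
Local Notation C := R[i].
Local Notation normc := (@Normc.normc R).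
Local Notation Re := (@complex.Re R).
Local Notation Im := (@complex.Im R).

(* An alias of the column vectors, whose canonical norm is the maximum of the
   entries rather than the Euclidean one. *)
Definition euclid : Type := 'cV[C]_n.

HB.instance Definition _ := Vector.copy euclid 'cV[C]_n.

Definition cdot (x y : euclid) : C := \sum_i x i 0 * Num.conj (y i 0).

Lemma cdot_bilinear : bilinear_for ( *%R ) (Num.conj \; *%R) cdot.
Proof.
split=> [y a u v|y a u v]; rewrite /cdot /=.
  rewrite mulr_sumr -big_split /=; apply: eq_bigr => i _.
  by rewrite !mxE mulrDl mulrA.
rewrite mulr_sumr -big_split /=; apply: eq_bigr => i _.
by rewrite !mxE rmorphD rmorphM /= mulrDr mulrCA.
Qed.

HB.instance Definition _ := bilinear_isBilinear.Build C euclid euclid C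
  ( *%R ) (Num.conj \; *%R) cdot cdot_bilinear.

Lemma cdot_hermitian x y : cdot x y = (-1) ^+ false * Num.conj (cdot y x).
Proof.
rewrite expr0 mul1r rmorph_sum; apply: eq_bigr => i _.
by rewrite rmorphM /= conjCK mulrC.
Qed.

HB.instance Definition _ := isHermitianSesquilinear.Build C euclid false Num.conj
  cdot cdot_hermitian.

Lemma cdot_gt0 x : x != 0 -> 0 < cdot x x.
Proof.
move=> x0; have H i : true -> 0 <= x i 0 * Num.conj (x i 0).
  by move=> _; exact: mul_conjC_ge0.
rewrite lt_def sumr_ge0// andbT psumr_eq0//; apply: contra x0 => /allP x0.
apply/eqP/colP => i; rewrite mxE.
by have := x0 i (mem_index_enum _); rewrite /= mul_conjC_eq0 => /eqP.
Qed.

HB.instance Definition _ := isDotProduct.Build C euclid cdot cdot_gt0.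

Definition enorm (x : euclid) : C := sqrtC (cdot x x).

Lemma enormD (x y : euclid) : enorm (x + y) <= enorm x + enorm y.
Proof. by have [] := triangle_lerif (cdot : {dot euclid for Num.conj}) x y. Qed.

Lemma enormZ (a : C) (x : euclid) : enorm (a *: x) = `|a| * enorm x.
Proof.
rewrite /enorm (dnormZ (cdot : {dot euclid for Num.conj})).
by rewrite rootCMl ?sqr_ge0// sqrCK.
Qed.

Lemma enorm_eq0 (x : euclid) : enorm x = 0 -> x = 0.
Proof.
by move=> /eqP; rewrite (sqrt_dnorm_eq0 (cdot : {dot euclid for Num.conj})) => /eqP.
Qed.

HB.instance Definition _ := Lmodule_isNormed.Build C euclid enormD enormZ enorm_eq0.

Lemma enorm_coord (x : euclid) i : `|x i 0| <= `|x|.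
Proof.
rewrite -(@ler_pXn2r _ 2) ?nnegrE ?normr_ge0// -[X in _ <= X ^+ 2]/(enorm x).
rewrite sqrtCK /cdot (bigD1 i)//= -normCK lerDl sumr_ge0// => j _.
exact: mul_conjC_ge0.
Qed.

Lemma enorm_le_sum (x : euclid) : `|x| <= \sum_i `|x i 0|.
Proof.
rewrite -(@ler_pXn2r _ 2) ?nnegrE ?normr_ge0 ?sumr_ge0//.
rewrite -[X in X ^+ 2 <= _]/(enorm x) sqrtCK /cdot expr2 mulr_suml.
apply: ler_sum => i _; rewrite -normCK expr2 ler_wpM2l//.
by rewrite (bigD1 i)//= lerDl sumr_ge0.
Qed.

(** [n.+1] rather than [n]: the sum of [n] terms stays strictly below [e], also for [n = 0]. *)
Lemma enorm_lt (x : euclid) (e : R) : 0 < e ->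
  (forall i, normc (x i 0) <= e / n.+1%:R) -> `|x| < e%:C%C.
Proof.
move=> e0 H; apply: le_lt_trans (enorm_le_sum x) _.
apply: (@le_lt_trans _ _ (\sum_(i < n) (e / n.+1%:R)%:C%C)).
  by apply: ler_sum => i _; rewrite lecR; exact: H.
rewrite sumr_const card_ord -rmorphMn ltcR -mulr_natr mulrAC ltr_pdivrMr ?ltr0n//.
by rewrite ltr_pM2l// ltr_nat.
Qed.

(** Real and imaginary parts of the coordinates are 1-Lipschitz, which reduces the claim to
    completeness of [R]. *)
Lemma euclid_complete (F : set_system euclid) : ProperFilter F -> cauchy F -> cvg F.
Proof.
move=> FF Fc.
have key (h : euclid -> R) : (forall x y, `|h x - h y|%:C%C <= `|x - y| :> C) ->
    exists c, forall e, 0 < e -> F [set x | `|h x - c| <= e].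
  move=> Hh.
  have : cauchy (h @ F).
    apply: cauchy_exP => e e0; have e0' : 0 < e%:C%C :> C by rewrite ltcR.
    have [x Hx] := (cauchyP F).1 Fc _ e0'; exists (h x).
    suff: F [set y | ball (h x) e (h y)] by [].
    apply: filterS Hx => y; rewrite -!ball_normE /= => Hy.
    by rewrite -ltcR; apply: le_lt_trans (Hh x y) Hy.
  move=> /cauchy_cvgP hc; exists (lim (h @ F)) => e e0.
  have := @cvgr_dist_le R R^o _ _ FF _ _ hc _ e0.
  by apply: filterS => x; rewrite distrC.
have keyC i : exists c : C, forall e : R, 0 < e ->
    F [set x | normc (x i 0 - c) <= e].
  have le_coord (x y : euclid) : (normc (x i 0 - y i 0))%:C%C <= `|x - y| :> C.
    by have := enorm_coord (x - y) i; rewrite !mxE.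
  have le_coordR (x y : C) : `|Re x - Re y|%:C%C <= (normc (x - y))%:C%C :> C.
    by rewrite lecR; apply: le_trans (normc_Re _); case: x y => [a b] [a' b'].
  have le_coordI (x y : C) : `|Im x - Im y|%:C%C <= (normc (x - y))%:C%C :> C.
    by rewrite lecR; apply: le_trans (normc_Im _); case: x y => [a b] [a' b'].
  have [a Ha] := key (fun x => Re (x i 0))
    (fun x y => le_trans (le_coordR (x i 0) (y i 0)) (le_coord x y)).
  have [b Hb] := key (fun x => Im (x i 0))
    (fun x y => le_trans (le_coordI (x i 0) (y i 0)) (le_coord x y)).
  exists (a +i* b)%C => e e0; have e20 : 0 < e / 2 by rewrite divr_gt0.
  apply: filterS2 (Ha _ e20) (Hb _ e20) => x /= H1 H2.
  apply: le_trans (normc_ReIm _) _; rewrite [leRHS]splitr; apply: lerD.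
  - by move: H1; case: (x i 0).
  - by move: H2; case: (x i 0).
pose c i : C := xget 0 [set c | forall e, 0 < e -> F [set x | normc (x i 0 - c) <= e]].
have Hc i e : 0 < e -> F [set x | normc (x i 0 - c i) <= e].
  move=> e0; rewrite /c.
  exact: (@xgetPex _ 0 [set c | forall e, 0 < e -> F [set x | normc (x i 0 - c) <= e]]
    (keyC i) e e0).
apply/cvg_ex; exists (\col_i c i : euclid).
apply/(@cvgrPdist_lt C euclid _ _ FF) => e e0.
have eE : e = (Re e)%:C%C by rewrite RRe_real// gtr0_real.
have e0' : 0 < Re e by rewrite -ltcR -eE.
have d0 : 0 < Re e / n.+1%:R by rewrite divr_gt0// ltr0n.
have := filter_forall FF (fun i => Hc i _ d0); apply: filterS => x H.
rewrite eE; apply: enorm_lt => // i.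
by rewrite !mxE normc_distC; exact: H.
Qed.

HB.instance Definition _ := Uniform_isComplete.Build euclid euclid_complete.

Lemma cdot_norm (u : euclid) : (cdot : {dot euclid for Num.conj}) u u = `|u| ^+ 2.
Proof. by rewrite -[`|u|]/(enorm u) sqrtCK. Qed.

HB.instance Definition _ := isHilbert.Build R euclid cdot_norm.

Lemma euclid_continuous (T : topologicalType) (f : T -> euclid) :
  (forall i, ccontinuous (fun t => f t i 0)) -> continuous f.
Proof.
move=> fc t; apply/(@cvgrPdist_lt C euclid _ _ (nbhs_filter t)) => e e0.
have eE : e = (Re e)%:C%C by rewrite RRe_real// gtr0_real.
have e0' : 0 < Re e by rewrite -ltcR -eE.
have d0 : 0 < Re e / n.+1%:R by rewrite divr_gt0// ltr0n.
have := filter_forall (nbhs_filter t) (fun i => fc i t _ d0); apply: filterS => x H.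
rewrite eE; apply: enorm_lt => // i.
by rewrite !mxE; exact: ltW (H i).
Qed.

End EuclideanSpace.

Section IrreducibleSubspace.
Variables (R : realType) (G : compactGroupType).
Local Notation C := R[i].
Local Notation CG := (contFun R G).
Local Notation normc := (@Normc.normc R).
Local Notation Re := (@complex.Re R).
Local Notation Im := (@complex.Im R).

Variables (Z : set CG) (e : seq CG).
Variable Zlin : linear_subspace Z.
Variable Zinv : forall s f, Z f -> Z (left_translate s f).
Variable eON : orthon e.
Variable eZ : forall u, u \in e -> Z u.
Variable Zproj : forall f, Z f -> f = oproj e f.

Local Notation n := (size e).
Local Notation H := (euclid R n).

Let b (i : 'I_n) : CG := e`_i.

Let b_in i : b i \in e. Proof. exact: mem_nth. Qed.

Let ip_b i j : ip (b i) (b j) = (i == j)%:R.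
Proof.
have [ue oe] := eON; rewrite (oe _ _ (b_in i) (b_in j)).
by rewrite /b nth_uniq.
Qed.

Let projE f : Z f -> f = \sum_i ip f (b i) *: b i.
Proof. by move=> /Zproj {1}->; rewrite /oproj (big_nth 0) big_mkord. Qed.

(** The order of the arguments of [ip] produces the conjugate of the matrix of left translation. The
    conjugate is forced: [coef xi eta] is conjugate-linear in [eta], and left translation by [s]
    replaces [eta] by its image under [s]. *)
Let B (t : G) : 'M[C]_n := \matrix_(j, i) ip (b j) (left_translate t (b i)).

Definition act (t : G) (x : H) : H := B t *m x.

Lemma act_linear t : linear (act t).
Proof. by move=> a u v; rewrite /act mulmxDr -scalemxAr. Qed.

HB.instance Definition _ t := GRing.isLinear.Build C H H _ (act t) (act_linear t).

(* The antiunitary map sending the standard basis to [e]; the representation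
   [act] is the conjugate of left translation on the span of [e]. *)
Let Phi (x : H) : CG := \sum_j ((x j 0)^*)%C *: b j.

Let Phi_Z x : Z (Phi x).
Proof. by apply: subspace_sum => // j _; apply: subspaceZ => //; exact: eZ. Qed.

Let Phi_ip x y : ip (Phi x) (Phi y) = ((cdot x y)^*)%C.
Proof.
rewrite /Phi ip_suml /cdot rmorph_sum; apply: eq_bigr => i _.
rewrite ipZl ip_sumr (bigD1 i)//= big1 => [|j ji]; last first.
  by rewrite ipZr ip_b eq_sym (negbTE ji) mulr0.
rewrite ipZr ip_b eqxx mulr1 addr0 conjcK rmorphM.
by congr (_ * _); rewrite [RHS]conjcK.
Qed.

Let PhiB x y : Phi (x - y) = Phi x - Phi y.
Proof.
rewrite /Phi -sumrB; apply: eq_bigr => i _.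
by rewrite !mxE rmorphB scalerBl.
Qed.

Let Phi_inj x y : Phi x = Phi y -> x = y.
Proof.
move=> E; apply/eqP; rewrite -subr_eq0; apply/negPn/negP => xy.
have := cdot_gt0 xy; rewrite -[cdot _ _]conjcK -Phi_ip PhiB E subrr ip0l conjc0.
by rewrite ltxx.
Qed.

Let Phi_act t x : Phi (act t x) = left_translate t (Phi x).
Proof.
have -> : left_translate t (Phi x) = \sum_i ((x i 0)^*)%C *: left_translate t (b i).
  apply: contFunP => u; rewrite /= !contFun_sum.
  by apply: eq_bigr => i _.
under [RHS]eq_bigr => i _.
  rewrite (projE (Zinv t (eZ (b_in i)))) scaler_sumr.
  over.
rewrite exchange_big /=; apply: eq_bigr => j _.
rewrite mxE rmorph_sum scaler_suml; apply: eq_bigr => i _.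
by rewrite rmorphM mxE [in RHS]ipC scalerA mulrC.
Qed.

(** [Phi] is injective and intertwines [act] with left translation, so the laws of translation pull
    back. *)
Let act1 x : act 1%g x = x.
Proof. by apply: Phi_inj; rewrite Phi_act translate1. Qed.

Let actM s t x : act (s * t)%g x = act s (act t x).
Proof. by apply: Phi_inj; rewrite !Phi_act translateM. Qed.

Let act_unitary s (x y : H) : inner (act s x) (act s y) = inner x y.
Proof.
rewrite -[LHS]/(cdot (act s x) (act s y)) -[RHS]/(cdot x y).
rewrite -[LHS]conjcK -[RHS]conjcK -!Phi_ip !Phi_act.
by rewrite ip_translate.
Qed.

Let B_cc i j : ccontinuous (fun t => B t i j).
Proof.
have Fc : ccontinuous (fun z : G * G => b i z.2 * ((b j (z.1^-1 * z.2)%g)^*)%C : C).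
  apply: ccontinuousM; first exact: ccontinuous_pair_fst (contFun_ccontinuous (b i)).
  apply: ccontinuous_conj.
  apply: (ccontinuous_comp (f := fun z : G * G => (z.1^-1 * z.2)%g)
    (g := (b j : G -> C)) _ (contFun_ccontinuous (b j))).
  apply: continuous_mulg2; last by move=> z; exact: cvg_snd.
  by apply: continuous_invg => z; exact: cvg_fst.
have -> : (fun t => B t i j) =
    (fun t => mean (fun u => b i u * ((b j (t^-1 * u)%g)^*)%C)).
  by apply: funext => t; rewrite /B mxE ipE.
exact: mean_continuous Fc.
Qed.

Let act_continuous (x : H) : continuous (fun t => act t x).
Proof.
apply: euclid_continuous => i.
have -> : (fun t => act t x i 0) = (fun t => \sum_j B t i j * x j 0).
  by apply: funext => t; rewrite /act mxE.
apply: ccontinuous_sum => j; apply: ccontinuousM; first exact: B_cc.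
exact: ccontinuous_cst.
Qed.

Definition subspace_rep : unitaryRep R G :=
  @UnitaryRep R G H act act1 actM act_unitary act_continuous.

Let xi : H := \col_i b i 1%g.

(** [xi] represents evaluation at the identity: [Phi y] at [1] equals [cdot xi y]. Moving [act t] to
    the other side and translating gives the value at [t]. *)
Lemma subspace_coef (y : H) : @coef R G subspace_rep xi y = Phi y.
Proof.
apply: contFunP => t; rewrite -[LHS]/(cdot (act t xi) y).
have -> : cdot (act t xi) y = cdot xi (act t^-1%g y).
  have := act_unitary t^-1%g (act t xi) y; rewrite -actM mulVg act1.
  by move=> E; symmetry; exact: E.
have -> : Phi y t = left_translate t^-1%g (Phi y) 1%g by rewrite /= invgK mulg1.
rewrite -Phi_act /Phi contFun_sum /cdot; apply: eq_bigr => j _.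
by rewrite mxE mulrC.
Qed.

Lemma subspace_coefP f : Z f -> exists y : H, f = @coef R G subspace_rep xi y.
Proof.
move=> Zf; exists (\col_i ((ip f (b i))^*)%C); rewrite subspace_coef [LHS]projE//.
by apply: eq_bigr => i _; rewrite mxE conjcK.
Qed.

(** Invariant subspaces of the representation correspond under [Phi] to invariant subspaces of [Z];
    conjugating scalars does not affect being a subspace. *)
Lemma subspace_irreducible : (exists f, Z f /\ f <> 0) ->
  (forall Z' : set CG, linear_subspace Z' ->
    (forall s f, Z' f -> Z' (left_translate s f)) -> Z' `<=` Z ->
    (forall f, Z' f -> f = 0) \/ Z `<=` Z') ->
  irreducible subspace_rep.
Proof.
move=> [f [Zf f0]] Zmin; split.
  have [y fy] := subspace_coefP Zf; exists y; apply/eqP => y0.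
  apply: f0; rewrite fy y0 subspace_coef /Phi big1// => j _.
  by rewrite mxE conjc0 scale0r.
move=> W _ [W0 WD] Winv.
pose Z' : set CG := [set g | exists2 w, W w & g = Phi w].
have [|||Z0|ZZ'] := Zmin Z'.
- apply/subspaceP; split.
    exists 0; first by have := W0; rewrite inE.
    by rewrite /Phi big1// => j _; rewrite mxE conjc0 scale0r.
  move=> a _ _ [u Wu ->] [v Wv ->]; exists ((a^*)%C *: u + v).
    by have := WD (a^*)%C u v; rewrite !inE; apply.
  rewrite /Phi scaler_sumr -big_split /=; apply: eq_bigr => j _.
  by rewrite !mxE rmorphD rmorphM /= conjcK scalerDl scalerA.
- move=> s _ [w Ww ->]; exists (act s w); last by rewrite Phi_act.
  exact: Winv.
- by move=> _ [w _ ->]; exact: Phi_Z.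
- left; apply/seteqP; split=> [w Ww|_ ->] /=; last by have := W0; rewrite inE.
  apply: Phi_inj; rewrite [LHS]Z0; last by exists w.
  by rewrite /Phi big1// => j _; rewrite mxE conjc0 scale0r.
- right; apply/seteqP; split=> // w _.
  by have [w' Ww' /Phi_inj ->] := ZZ' _ (Phi_Z w).
Qed.

Lemma subspace_irrep : (exists f, Z f /\ f <> 0) ->
  (forall Z' : set CG, linear_subspace Z' ->
    (forall s f, Z' f -> Z' (left_translate s f)) -> Z' `<=` Z ->
    (forall f, Z' f -> f = 0) \/ Z `<=` Z') ->
  exists (p : irrep R G) (x : rep_space p),
    (forall f, Z f -> exists y, f = coef x y) /\ (forall y, Z (coef x y)).
Proof.
move=> Z0 Zmin; exists (Irrep (subspace_irreducible Z0 Zmin)), xi.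
split=> [f|y]; first exact: subspace_coefP.
by rewrite subspace_coef.
Qed.

End IrreducibleSubspace.

(** * Density *)

Section Density.
Variables (R : realType) (G : compactGroupType).
Local Notation C := R[i].
Local Notation CG := (contFun R G).
Local Notation normc := (@Normc.normc R).
Local Notation Re := (@complex.Re R).
Local Notation Im := (@complex.Im R).
Implicit Types (f g h : CG) (V Z W : set CG).

Definition invariant V := forall s f, V f -> V (left_translate s f).

Definition spanned_by V (e : seq CG) :=
  [/\ orthon e, (forall u, u \in e -> V u) & forall f, V f -> f = oproj e f].

Definition minimal_invariant Z :=
  (exists f, Z f /\ f <> 0) /\
  forall Z', linear_subspace Z' -> invariant Z' -> Z' `<=` Z ->
    (forall f, Z' f -> f = 0) \/ Z `<=` Z'.

(** [Z] has the least dimension among nonzero invariant subspaces of [W]. If [Z'] missed some [z] in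
    [Z], a basis of [Z'] could be lengthened inside [Z], contradicting that choice. *)
Lemma minimal_invariant_exists W N : linear_subspace W -> invariant W ->
  (forall s, orthon s -> (forall u, u \in s -> W u) -> (size s <= N)%N) ->
  (exists f, W f /\ f <> 0) ->
  exists Z e, [/\ linear_subspace Z, invariant Z, Z `<=` W, spanned_by Z e &
    minimal_invariant Z].
Proof.
move=> Wl Wi WN W0.
pose Q Z e := [/\ linear_subspace Z, invariant Z, Z `<=` W &
    exists f, Z f /\ f <> 0] /\ (spanned_by Z e /\
    forall s, orthon s -> (forall u, u \in s -> Z u) -> (size s <= size e)%N).
have Qex Z : linear_subspace Z -> invariant Z -> Z `<=` W ->
    (exists f, Z f /\ f <> 0) -> exists e, Q Z e.
  move=> Zl Zi ZW Z0.
  have [|e [eo eZ ep em]] := @max_orthon _ _ Z N Zl.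
    by move=> s so sZ; apply: WN => // u us; apply: ZW; exact: sZ.
  by exists e; split.
pose P n := `[< exists Z e, Q Z e /\ size e = n >].
have Pex : exists n, P n.
  have [e Qe] := Qex W Wl Wi (@subset_refl _ W) W0.
  by exists (size e); apply/asboolP; exists W, e.
case: (ex_minnP Pex) => n /asboolP[Z [e [[[Zl Zi ZW Z0] [Ze Zm]] en]]] nmin.
exists Z, e; split=> //; split=> // Z' Z'l Z'i Z'Z.
have [Z'0|] := pselect (exists f, Z' f /\ f <> 0); last first.
  by move=> Z'0; left=> f Z'f; apply: contrapT => f0; apply: Z'0; exists f.
right=> z Zz; apply: contrapT => Z'z.
have [|e' Qe'] := Qex Z' Z'l Z'i _ Z'0; first exact: subset_trans Z'Z ZW.
have ne' : (n <= size e')%N by apply: nmin; apply/asboolP; exists Z', e'.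
have [_ [[e'o e'Z' _] _]] := Qe'.
have [|s [so sZ ss]] := @orthon_extend _ _ Z e' z Zl e'o
    (fun u us => Z'Z _ (e'Z' _ us)) Zz.
  by move=> E; apply: Z'z; rewrite E; exact: subspace_proj.
by have := Zm s so sZ; rewrite ss en ltnNge ne'.
Qed.

Variable X : set CG.
Variables (Xc : closed X) (Xl : linear_subspace X) (Xi : invariant X).
Variable Y : set CG.
Variable Yl : linear_subspace Y.
(** The only link to representations: the density argument sees [Y] merely as a subspace containing
    these minimal invariant pieces. *)
Variable minimal_Y : forall Z e, linear_subspace Z -> invariant Z -> Z `<=` X ->
  spanned_by Z e -> minimal_invariant Z -> Z `<=` Y.

Section Operator.
Variables (phi : G -> C) (K : R).
Variable phi_cc : ccontinuous phi.
Variable phi_le : forall x, normc (phi x) <= K.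
Variable phi_real : forall x, ((phi x)^*)%C = phi x.
Variable phi_inv : forall x, phi x^-1%g = phi x.
Variable phi_class : forall x y, phi (x * y)%g = phi (y * x)%g.
Local Notation T := (convol phi_cc).

(** By [convol_Bessel] the length is at most [K ^+ 2 / e]. This makes the eigenspaces
    finite-dimensional and stops the enlargement of [V] below. *)
Lemma orthon_size_bound (e : R) : 0 < e -> exists N, forall s, orthon s ->
  (forall u, u \in s -> e <= sqn (T u)) -> (size s <= N)%N.
Proof.
move=> e0; exists (Num.bound (K ^+ 2 / e)) => s so sT.
have H : (size s)%:R * e <= K ^+ 2.
  apply: le_trans (convol_Bessel phi_cc phi_le so).
  rewrite -[leLHS]addr0 mulr_natl -(count_predT s) -iter_addr -big_const_seq.
  by rewrite big_seq_cond [leRHS]big_seq_cond; apply: ler_sum => u /andP[us _]; exact: sT.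
have B0 : 0 <= K ^+ 2 / e by rewrite divr_ge0 ?sqr_ge0 ?ltW.
rewrite -(@ler_nat R) ltW//; apply: le_lt_trans (archi_boundP B0).
by rewrite ler_pdivlMr.
Qed.

Definition orthogonal_to V f := forall v, V v -> ip f v = 0.

Lemma orthogonal_closed V : closed (X `&` orthogonal_to V).
Proof.
move=> f /approx_closure Hf; split.
  apply: closed_approx; first exact: Xc.
  by move=> d d0; have [g [Xg _] H] := Hf d d0; exists g.
move=> v Vv; apply: Normc.eq0_normc; apply/eqP.
rewrite eq_le normc_ge0 andbT.
apply: (@le0_small _ _ (Num.sqrt (sqn v))); first exact: sqrtr_ge0.
move=> d d0 _; have [g [_ Vg] H] := Hf d d0.
have -> : ip f v = ip (f - g) v by rewrite ipBl (Vg v Vv) subr0.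
rewrite -(@ler_pXn2r _ 2) ?nnegrE ?normc_ge0 ?mulr_ge0 ?sqrtr_ge0 ?(ltW d0)//.
rewrite exprMn sqr_sqrtr ?sqn_ge0//.
apply: (le_trans (ip_CauchySchwarz (f - g) v)).
rewrite mulrC; apply: ler_wpM2l; [exact: sqn_ge0|].
exact: (@sqn_le _ _ (f - g) d H).
Qed.

(** The complement of [V] in [X] is stable under [T] by self-adjointness and under translations by
    unitarity, so [eigenvector] applies there; a minimal invariant part of the resulting eigenspace
    is [Z]. *)
Lemma new_component V (e : R) r : 0 < e -> linear_subspace V -> invariant V ->
  (forall f, V f -> V (T f)) -> X r -> orthogonal_to V r ->
  e * sqn r < sqn (T r) ->
  exists Z (nu : R), [/\ linear_subspace Z, invariant Z, Z `<=` X `&` Y, 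
    Z `<=` orthogonal_to V & exists f, Z f /\ f <> 0] /\
    (forall f, Z f -> T f = (nu%:C)%C *: f) /\ e <= nu ^+ 2.
Proof.
move=> e0 Vl Vi VT Xr Vr Hr.
pose Y0 := X `&` orthogonal_to V.
have Y0l : linear_subspace Y0.
  apply/subspaceP; split.
    by split; [case/subspaceP: Xl|move=> v _; exact: ip0l].
  move=> a u v [Xu Vu] [Xv Vv]; split; first by case/subspaceP: Xl => _; apply.
  by move=> w Vw; rewrite ipDl ipZl (Vu w Vw) (Vv w Vw) mulr0 addr0.
have Y0T f : Y0 f -> Y0 (T f).
  move=> [Xf Vf]; split; first exact: convol_closed.
  by move=> v Vv; rewrite (convol_sym phi_cc phi_real phi_inv); apply: Vf; exact: VT.
have Y0i : invariant Y0.
  move=> s f [Xf Vf]; split; first exact: Xi.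
  move=> v Vv; rewrite -(ip_translate s^-1%g) -translateM mulVg translate1.
  by apply: Vf; exact: Vi.
have [nu [h [Y0h h0 Th enu]]] := eigenvector phi_le phi_real phi_inv
  (@orthogonal_closed V) Y0l Y0T e0 (conj Xr Vr : Y0 r) Hr.
pose W := [set f | Y0 f /\ T f = (nu%:C)%C *: f].
have Wl : linear_subspace W.
  apply/subspaceP; split.
    split; first by case/subspaceP: Y0l.
    by rewrite convol0 scaler0.
  move=> a u v [Yu Tu] [Yv Tv]; split; first by case/subspaceP: Y0l => _; apply.
  by rewrite convol_linear Tu Tv scalerDr !scalerA mulrC.
have Wi : invariant W.
  move=> s f [Yf Tf]; split; first exact: Y0i.
  by rewrite (convol_translate phi_cc phi_class) Tf translateZ.
have [N HN] := orthon_size_bound e0.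
have [||Z [b [Zl Zi ZW Zb Zm]]] := @minimal_invariant_exists W N Wl Wi.
- move=> s so sW; apply: (HN s so) => u us; have [_ ->] := sW u us.
  rewrite sqnZ normc_real real_normK ?num_real//.
  have : ip u u = 1 by rewrite (so.2 u u us us) eqxx.
  by rewrite ip_sqn => /complexI ->; rewrite mulr1.
- by exists h.
have ZX : Z `<=` X by move=> f /ZW[[]].
exists Z, nu; split; last by split; [move=> f /ZW[]|exact: enu].
split; [exact: Zl|exact: Zi| |by move=> f /ZW[[]]|exact: Zm.1].
by move=> f Zf; split; [exact: ZX|exact: (minimal_Y Zl Zi ZX Zb Zm)].
Qed.

(** [V] is chosen with an orthonormal list of maximal length among invariant subspaces on which [T]
    is bounded below by [e]. A vector [r] violating the bound would supply a component [Z] by which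
    [V] could grow. *)
Lemma almost_invariant_complement (e : R) : 0 < e ->
  exists V b, [/\ linear_subspace V, (forall f, V f -> V (T f)), V `<=` Y,
    V `<=` X & spanned_by V b] /\
  forall r, X r -> orthogonal_to V r -> sqn (T r) <= e * sqn r.
Proof.
move=> e0; have [N HN] := orthon_size_bound e0.
pose Q V (b : seq CG) := [/\ linear_subspace V, invariant V,
  (forall f, V f -> V (T f)), V `<=` X `&` Y &
  forall f, V f -> e * sqn f <= sqn (T f)] /\
  (orthon b /\ forall u, u \in b -> V u).
have QN V b : Q V b -> (size b <= N)%N.
  move=> [[_ _ _ _ VT] [bo bV]]; apply: (HN b bo) => u ub.
  apply: le_trans (VT _ (bV _ ub)).
  have : ip u u = 1 by rewrite (bo.2 u u ub ub) eqxx.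
  by rewrite ip_sqn => /complexI ->; rewrite mulr1.
pose P n := `[< exists V b, Q V b /\ size b = n >].
have Pex : exists n, P n.
  exists 0%N; apply/asboolP; exists [set 0], [::]; split=> //; split=> //.
  split.
  - by apply/subspaceP; split=> // a u v -> ->; rewrite scaler0 addr0.
  - by move=> s f ->; apply: contFunP.
  - by move=> f ->; exact: convol0.
  - by move=> f ->; split; [case/subspaceP: Xl|case/subspaceP: Yl].
  - by move=> f ->; rewrite convol0 sqn0 mulr0.
have PN n : P n -> (n <= N)%N by move=> /asboolP[V [b [Qb <-]]]; exact: QN Qb.
case: (ex_maxnP Pex PN) => n /asboolP[V [b [Qb bn]]] nmax.
have [[Vl Vi VT VXY Ve] [bo bV]] := Qb.
exists V, b; split.
  split=> //; [by move=> f /VXY[]|by move=> f /VXY[]|split=> // f Vf].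
  apply: contrapT => fn.
  have [b' [b'o b'V b's]] := orthon_extend Vl bo bV Vf fn.
  have : P (size b') by apply/asboolP; exists V, b'.
  by move=> /nmax; rewrite b's bn ltnn.
move=> r Xr Vr; rewrite leNgt; apply/negP => Hr.
have [Z [nu [[Zl Zi ZXY ZV [z [Zz z0]]] [Znu enu]]]] :=
  new_component e0 Vl Vi VT Xr Vr Hr.
have [a a0 za] := normalize z0.
have Zaz : Z (a *: z) by exact: subspaceZ.
pose V' := [set f | exists v w, [/\ V v, Z w & f = v + w]].
suff : Q V' (a *: z :: b).
  move=> QV'; have : P (size (a *: z :: b)) by apply/asboolP; exists V', (a *: z :: b).
  by move=> /nmax; rewrite /= bn ltnn.
have [V0 Vlin] := (subspaceP V).1 Vl; have [Z0 Zlin] := (subspaceP Z).1 Zl.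
split; [split|split].
- apply/subspaceP; split; first by exists 0, 0; rewrite addr0.
  move=> k _ _ [v [w [Vv Zw ->]]] [v' [w' [Vv' Zw' ->]]].
  exists (k *: v + v'), (k *: w + w'); split; [exact: Vlin|exact: Zlin|].
  by rewrite scalerDr addrACA.
- move=> s _ [v [w [Vv Zw ->]]].
  exists (left_translate s v), (left_translate s w).
  by split; [exact: Vi|exact: Zi|exact: translateD].
- move=> _ [v [w [Vv Zw ->]]]; exists (T v), (T w).
  split; [exact: VT| |exact: convolD].
  by rewrite (Znu w Zw); exact: subspaceZ.
- move=> _ [v [w [Vv Zw ->]]]; have [Xv Yv] := VXY v Vv; have [Xw Yw] := ZXY w Zw.
  by split; exact: subspaceD.
(* [V] and [Z] are orthogonal and both stable under [T], so the two lower bounds add up by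
   Pythagoras. *)
- move=> _ [v [w [Vv Zw ->]]].
  have wv u : V u -> Re (ip u w) = 0.
    by move=> Vu; rewrite ipC (ZV w Zw u Vu) conjc0.
  have Zw' : Z (T w) by rewrite (Znu w Zw); exact: subspaceZ.
  have E : Re (ip (T v) (T w)) = 0.
    by rewrite ipC (ZV _ Zw' _ (VT v Vv)) conjc0.
  have D1 : sqn (v + w) = sqn v + sqn w by rewrite sqnD (wv v Vv) mulr0 addr0.
  have D2 : sqn (T v + T w) = sqn (T v) + sqn (T w) by rewrite sqnD E mulr0 addr0.
  rewrite convolD D1 D2 mulrDr; apply: lerD; first exact: Ve.
  rewrite (Znu w Zw) sqnZ normc_real real_normK ?num_real//.
  by apply: ler_wpM2r enu; exact: sqn_ge0.
- apply: (orthon_cons bo za) => u ub; rewrite ipZl (ZV z Zz u (bV u ub)); exact: mulr0.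
- move=> u; rewrite inE => /orP[/eqP->|ub].
    by exists 0, (a *: z); split=> //; rewrite add0r.
  by exists u, 0; split; [exact: bV|exact: Z0|rewrite addr0].
Qed.

End Operator.

Lemma convol_sup (phi : G -> R) (phic : ccontinuous (fun x => (phi x)%:C%C)) h M :
  continuous phi -> (forall x, 0 <= phi x) -> (forall x, normc (h x) <= M) ->
  forall t, normc (convol phic h t) <= Re (mean (fun x => (phi x)%:C%C)) * M.
Proof.
move=> pc p0 hM t; rewrite convol_shift.
have hc : ccontinuous (fun s => h (s^-1 * t)%g : C).
  apply: (ccontinuous_comp (f := fun s : G => (s^-1 * t)%g) (g := (h : G -> C)) _
    (contFun_ccontinuous h)).
  apply: continuous_mulg2; last exact: cst_continuous.
  by apply: continuous_invg => z; exact: cvg_id.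
have qc : continuous (fun s => phi s * M).
  by move=> s; apply: (@cvgM R); [exact: pc|exact: cvg_cst].
apply: (le_trans (mean_normc_le (ccontinuousM phic hc) qc _)) => [s|].
  by rewrite Normc.normcM normc_real ger0_norm// ler_wpM2l.
suff -> : mean (fun s => (phi s * M)%:C%C) = M%:C%C * mean (fun x => (phi x)%:C%C).
  by case: (mean _) => a b /=; rewrite mul0r subr0 mulrC.
rewrite -(meanZ _ phic); apply: eq_mean => s.
by rewrite mulrC; exact: rmorphM.
Qed.

Lemma dense_closure f : X f -> closure Y f.
Proof.
move=> Xf; apply: closure_approx => d d0.
(* Three errors of size [c ^+ 2 * e] will occur before division by [c ^+ 2]. *)
pose e := d / 3; have e0 : 0 < e by rewrite divr_gt0.
have [phi [pc pb p1 [pinv pclass] Hphi]] := central_bump f e0.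
have p0 x : 0 <= phi x by case/andP: (pb x).
have phic := ccontinuous_real pc.
set m := mean (fun x => (phi x)%:C%C); pose c := Re m.
have c0 : 0 < c.
  apply: (@mean_gt0 _ _ _ 1%g phic) => [x|]; first exact: p0.
  by rewrite -[Re _]/(phi 1%g) p1.
have mE : m = c%:C%C.
  have : Im m = 0 by apply: (mean_real phic) => x.
  by rewrite /c; move: (m) => [a b0] /= ->.
have phi_le x : normc (phi x)%:C%C <= e.
  by rewrite normc_real (ger0_norm (p0 x)); case/andP: (pb x).
have phi_real x : (((phi x)%:C)^*)%C = (phi x)%:C%C by exact: conjc_real.
have phi_inv x : (phi x^-1%g)%:C%C = (phi x)%:C%C by rewrite pinv.
have phi_class x y : (phi (x * y)%g)%:C%C = (phi (y * x)%g)%:C%C by rewrite pclass.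
(* The threshold [(c ^+ 2 * e) ^+ 2 / B] makes the bound of [convol_le] for [T (T r)] at most
   [(c ^+ 2 * e) ^+ 2]; the summand [1] keeps [B] positive when [f = 0]. *)
pose B := e ^+ 2 * sqn f + 1.
have B0 : 0 < B.
  by apply: ltr_wpDl; [rewrite mulr_ge0 ?sqr_ge0 ?sqn_ge0|exact: ltr01].
have c20 : 0 < c ^+ 2 by exact: exprn_gt0.
have c2e0 : 0 < c ^+ 2 * e by exact: mulr_gt0.
have eps0 : 0 < (c ^+ 2 * e) ^+ 2 / B by rewrite divr_gt0// exprn_gt0.
have [V [b [[Vl VT VY VX [bo bV bp]] HV]]] :=
  almost_invariant_complement phic phi_le phi_real phi_inv phi_class eps0.
pose T := convol phic; pose P := oproj b f; pose r := f - P.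
have VP : V P by exact: subspace_proj.
have Xr : X r by apply: subspaceB Xl Xf _; exact: VX.
have Vr : orthogonal_to V r.
  by move=> v Vv; rewrite (bp v Vv) /r /P ip_sub_proj_proj.
have rf : sqn r <= sqn f by rewrite (sqn_pythagoras f bo) lerDl sqn_ge0.
have TTr t : normc (T (T r) t) <= c ^+ 2 * e.
  rewrite -(@ler_pXn2r _ 2) ?nnegrE ?normc_ge0 ?(ltW c2e0)//.
  apply: (le_trans (convol_le phic phi_le _ _)).
  apply: (@le_trans _ _ (e ^+ 2 * ((c ^+ 2 * e) ^+ 2 / B * sqn f))).
    apply: ler_wpM2l; first exact: sqr_ge0.
    by apply: le_trans (HV r Xr Vr) _; apply: ler_wpM2l rf; exact: ltW.
  rewrite mulrCA mulrAC ler_pdivrMr//; apply: ler_wpM2l; first exact: sqr_ge0.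
  by rewrite lerDl.
have ce := convol_approx phic pc p0 Hphi; rewrite -/m mE in ce.
(* The difference is [T] of [T f - c f], plus [c] times [T f - c f]; either term is at most
   [c * (c * e)]. *)
have TTf t : normc (T (T f) t - (c ^+ 2)%:C%C * f t) <= c ^+ 2 * e + c ^+ 2 * e.
  have -> : T (T f) t - (c ^+ 2)%:C%C * f t =
      T (T f - c%:C%C *: f) t + c%:C%C * (T f t - c%:C%C * f t).
    rewrite /T convolB convolZ contFunB contFunZ mulrBr mulrA expr2 -rmorphM.
    by rewrite addrA subrK.
  apply: (le_trans (le_normcD _ _)); rewrite expr2 -mulrA; apply: lerD.
    exact: (@convol_sup phi phic (T f - c%:C%C *: f) (c * e) pc p0 ce).
  rewrite Normc.normcM normc_real (ger0_norm (ltW c0)).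
  exact: ler_wpM2l (ltW c0) _ _ (ce t).
exists (((c ^+ 2)^-1)%:C%C *: T (T P)).
  exact: VY _ (subspaceZ _ Vl (VT _ (VT _ VP))).
move=> t; rewrite contFunZ.
have -> : f t - ((c ^+ 2)^-1)%:C%C * T (T P) t =
    ((c ^+ 2)^-1)%:C%C * ((c ^+ 2)%:C%C * f t - T (T P) t).
  by rewrite mulrBr mulrA -rmorphM mulVf ?gt_eqF// rmorph1 mul1r.
rewrite Normc.normcM normc_real ger0_norm ?invr_ge0 ?(ltW c20)//.
rewrite ler_pdivrMl//.
apply: (le_trans (normc_triangle (T (T f) t) _ _)).
have -> : c ^+ 2 * d = (c ^+ 2 * e + c ^+ 2 * e) + c ^+ 2 * e.
  by rewrite /e; field.
apply: lerD; first by rewrite normc_distC.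
by have := TTr t; rewrite /r /T !convolB contFunB.
Qed.

End Density.

(** * Spans of coefficients, and transport along unitary equivalences *)

Section Span.
Variables (R : realType) (G : compactGroupType).
Local Notation CG := (contFun R G).

Lemma linear_span_subspace (A : set CG) : linear_subspace (linear_span A).
Proof.
apply/subspaceP; split=> [B [Bl _]|a u v Hu Hv B BB].
  by case/subspaceP: Bl.
by have [/subspaceP[_ H] _] := BB; apply: H; [exact: Hu|exact: Hv].
Qed.

Lemma sub_linear_span (A : set CG) : A `<=` linear_span A.
Proof. by move=> f Af B [_ AB]; exact: AB. Qed.

Lemma linear_span_min (A B : set CG) : linear_subspace B -> A `<=` B ->
  linear_span A `<=` B.
Proof. by move=> Bl AB f; apply; split. Qed.

Lemma coef_linear (p : unitaryRep R G) a (x y z : rep_space p) :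
  coef (a *: x + y) z = a *: coef x z + coef y z.
Proof.
apply: contFunP => t; rewrite contFunD contFunZ /=.
by rewrite linearP linearDl linearZl_LR.
Qed.

Lemma coef_intertwine (p q : unitaryRep R G)
    (U : {linear rep_space p -> rep_space q}) (x y : rep_space p) :
  (forall u v, inner (U u) (U v) = inner u v) ->
  (forall t u, U (p t u) = q t (U u)) ->
  coef (U x) (U y) = coef x y.
Proof. by move=> Uu Ui; apply: contFunP => t; rewrite /= -Ui Uu. Qed.

End Span.

Theorem corollary6p6 (R : realType) (G : compactGroupType)
    (repr : unitary_dual R G -> irrep R G)
    (reprP : forall c : unitary_dual R G, c (repr c))
    (X : set (contFun R G)) (Xclosed : closed X) (Xlin : linear_subspace X)
    (Xinv : forall (s : G) (f : contFun R G), X f -> X (left_translate s f)) :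
  exists E : forall c : unitary_dual R G, set (rep_space (repr c)),
    (forall c, linear_subspace (E c)) /\
    X = closure (linear_span
          [set f | exists (c : unitary_dual R G) (xi eta : rep_space (repr c)),
                     E c xi /\ f = coef xi eta]).
Proof.
have [X0 XD] := (subspaceP X).1 Xlin.
(* The largest candidate: any valid choice of subspaces is contained in this one. *)
exists (fun c => [set xi | forall eta : rep_space (repr c), X (coef xi eta)]).
split=> [c|].
  split=> [|a u v]; rewrite !inE /=.
    move=> y; suff -> : coef (0 : rep_space (repr c)) y = 0 by [].
    by apply: contFunP => t; rewrite /= linear0 linear0l.
  by move=> Xu Xv y; rewrite coef_linear; exact: XD.
set A := [set f | _].
have spanX : linear_span A `<=` X.
  by apply: linear_span_min => // f [c [x [y [Hx ->]]]]; exact: Hx.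
apply/seteqP; split=> [f Xf|].
  apply: (dense_closure Xclosed Xlin Xinv (linear_span_subspace A)) Xf.
  move=> Z e Zl Zi ZX [eo eZ ep] [Z0 Zm].
  have [p [x [H1 H2]]] := subspace_irrep Zl Zi eo eZ ep Z0 Zm.
  (* The representative of the class of [p] is only equivalent to [p], so vectors are moved by [U],
     which preserves coefficients. Surjectivity of [U] is what lets [U x] be tested against every
     [eta]. *)
  pose c : unitary_dual R G := UnitaryDual (ex_intro _ p erefl).
  have [U [Us Uu Ui]] : unitarily_equivalent p (repr c) := reprP c.
  move=> g /H1[y ->]; apply: sub_linear_span.
  exists c, (U x), (U y); split; last by rewrite coef_intertwine.
  move=> eta; have [y' <-] := Us eta.
  by rewrite coef_intertwine//; apply: ZX; exact: H2.
rewrite [X in _ `<=` X](closure_id X).1//; exact: closure_subset.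
Qed.
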